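(* Let $D\subseteq\mathbb{R}^N$ be an open set, let $A$ be an $N$-function satisfying the $\Delta_2$ condition, let $s\in(0,1)$, and let $$\alpha_{s,A}(\lambda):=\sup_{t>0}\frac{A(\lambda t)}{\lambda^{1/s}A(t)}.$$ Then the fractional Orlicz Hardy inequality $FOHI(s,A)$ holds in $D$, that is, $H_{N,s,A}(D)>0$, in each of the following cases: (1) $D=\{(x',x_N)\in\mathbb{R}^N: x'\in\mathbb{R}^{N-1},\ x_N>\Phi(x')\}$, where $\Phi:\mathbb{R}^{N-1}\to\mathbb{R}$ is a Lipschitz map, and $s,A$ are such that $\liminf_{\lambda\to0+}\alpha_{s,A}(\lambda)=0$ or $\liminf_{\lambda\to\infty}\alpha_{s,A}(\lambda)=0$; (2) $D^c$ is the closure of some bounded Lipschitz domain, and $s,A$ satisfy at least one of the following: (a) $\liminf_{\lambda\to\infty}\lambda^{\frac{1-N}{s}}\alpha_{s,A}(\lambda)=0$ and $\liminf_{\lambda\to0+}\alpha_{s,A}(\lambda)=0$; (b) $\liminf_{\lambda\to0+}\lambda^{\frac{1-N}{s}}\alpha_{s,A}(\lambda)=0$; (c) $\liminf_{\lambda\to\infty}\alpha_{s,A}(\lambda)=0$.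
   Context: An $N$-function is a continuous convex function $A:[0,\infty)\to[0,\infty)$ with $\lim_{t\to0}A(t)/t=0$ and $\lim_{t\to\infty}A(t)/t=\infty$. $A$ satisfies the $\Delta_2$ condition ($A\in\Delta_2$) if there is a constant $p>0$ with $A(2t)\le pA(t)$ for all $t>0$ (this forces $A(t)>0$ for $t>0$). A domain is a nonempty connected open set. A bounded domain $U\subset\mathbb{R}^N$ is Lipschitz if there are constants $r_0>0$ and $\mathrm{Lip}(U)<\infty$ such that for each $z\in\partial U$ there are a linear isometry $L_z:\mathbb{R}^N\to\mathbb{R}^N$ and a Lipschitz function $\phi_z:\mathbb{R}^{N-1}\to\mathbb{R}$ with Lipschitz constant at most $\mathrm{Lip}(U)$ such that $L_z(U)\cap B(L_z(z),r_0)=\{x=(\tilde x,x_N)\in\mathbb{R}^N: x_N>\phi_z(\tilde x)\}\cap B(L_z(z),r_0)$. For an open set $D\subsetneq\mathbb{R}^N$, $\delta_x=\delta_D(x):=\inf\{|x-y|:y\in D^c\}$, $$M_{W^{s,A}(D)}(f):=\iint_{D\times D}A\left(\frac{|f(x)-f(y)|}{|x-y|^s}\right)\frac{dx\,dy}{|x-y|^N},\qquad H_{N,s,A}(D):=\inf_{f\in C_c^\infty(D),\,f\ne0}\frac{M_{W^{s,A}(D)}(f)}{\int_D A\left(|f(x)|/\delta_x^s\right)dx}.$$ $FOHI(s,A)$ holds in $D$ if $H_{N,s,A}(D)>0$. *)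

(* Defs.v *)
From HB Require Import structures.
From mathcomp Require Import all_boot all_order all_algebra.
From mathcomp Require Import all_classical all_reals all_analysis.

Set Implicit Arguments.
Unset Strict Implicit.
Unset Printing Implicit Defensive.

Import Order.TTheory GRing.Theory Num.Theory.
Import numFieldNormedType.Exports.

Local Open Scope classical_set_scope.
Local Open Scope ring_scope.

(* Row vectors carry the product sigma-algebra, as n.-tuple does in the library;
   on 'rV[R]_n this is the Borel sigma-algebra. *)
Definition measure_row_display : measure_display -> measure_display.
Proof. exact. Qed.

Section measurable_row.
Context {d} {T : sigmaRingType d}.
Variable n : nat.

Let coors : 'I_n -> 'rV[T]_n -> T := fun i x => x ord0 i.

Let row_set0 : g_sigma_preimage coors set0.
Proof. exact: sigma_algebra0. Qed.

Let row_setC A : g_sigma_preimage coors A -> g_sigma_preimage coors (~` A).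
Proof. exact: sigma_algebraC. Qed.

Let row_bigcup (F : (set 'rV[T]_n)^nat) :
  (forall i, g_sigma_preimage coors (F i)) ->
  g_sigma_preimage coors (\bigcup_i (F i)).
Proof. exact: sigma_algebra_bigcup. Qed.

HB.instance Definition _ := @isMeasurable.Build (measure_row_display d)
  'rV[T]_n (g_sigma_preimage coors) row_set0 row_setC row_bigcup.

End measurable_row.

Section measurable_row_theory.
Context d1 d2 (T1 : measurableType d1) (T2 : measurableType d2).

Lemma measurable_coord n (i : 'I_n) :
  measurable_fun [set: 'rV[T2]_n] (fun x : 'rV[T2]_n => x ord0 i).
Proof.
move=> _ Y mY; rewrite setTI; apply: sub_sigma_algebra => /=.
rewrite -bigcup_seq/=; exists i => /=; first by rewrite mem_index_enum.
by exists Y => //; rewrite setTI.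
Qed.

Lemma measurable_fun_rowP n (f : T1 -> 'rV[T2]_n) :
  measurable_fun [set: T1] f <->
  forall i, measurable_fun [set: T1] (fun t => f t ord0 i).
Proof.
split=> [mf i|mf].
  exact: (measurableT_comp (measurable_coord i) mf).
move=> _ A mA; rewrite setTI.
have : g_sigma_preimage (fun i t => f t ord0 i) `<=` measurable.
  apply: smallest_sub; first exact: sigma_algebra_measurable.
  rewrite -bigcup_seq/=; apply: bigcup_sub => i _.
  by move=> B [C mC <-]; exact: mf.
apply.
rewrite (g_sigma_preimage_comp (fun i (x : 'rV[T2]_n) => x ord0 i) f).
by exists A => //; rewrite setTI.
Qed.
End measurable_row_theory.

Section lebesgue_row.
Context {R : realType}.

(* A point x of R^n.+1 is split as (x', x_n.+1), the last coordinate apart. *)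
Definition row_init n (x : 'rV[R]_n.+1) : 'rV[R]_n :=
  \row_(j < n) x ord0 (lift ord_max j).

Definition row_last n (x : 'rV[R]_n.+1) : R := x ord0 ord_max.

Definition row_rcons n (p : 'rV[R]_n * R) : 'rV[R]_n.+1 :=
  \row_(i < n.+1) oapp (p.1 ord0) p.2 (unlift ord_max i).

Lemma row_init_rcons n (p : 'rV[R]_n * R) : row_init (row_rcons p) = p.1.
Proof. by apply/rowP => j; rewrite !mxE liftK. Qed.

Lemma row_last_rcons n (p : 'rV[R]_n * R) : row_last (row_rcons p) = p.2.
Proof. by rewrite /row_last mxE unlift_none. Qed.

Lemma row_rconsK n (x : 'rV[R]_n.+1) : row_rcons (row_init x, row_last x) = x.
Proof.
by apply/rowP => i; rewrite mxE; case: unliftP => [j|] -> //=; rewrite mxE.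
Qed.

Lemma measurable_row_rcons n :
  measurable_fun [set: 'rV[R]_n * R] (@row_rcons n).
Proof.
apply/measurable_fun_rowP => i.
case: (unliftP ord_max i) => [j|] ->.
- under eq_fun do rewrite mxE liftK /=.
  exact: (measurableT_comp (measurable_coord j) measurable_fst).
- under eq_fun do rewrite mxE unlift_none /=.
  exact: measurable_snd.
Qed.

Lemma measurable_row_init n : measurable_fun [set: 'rV[R]_n.+1] (@row_init n).
Proof.
apply/measurable_fun_rowP => i; under eq_fun do rewrite mxE.
exact: measurable_coord.
Qed.

Lemma measurable_row_last n : measurable_fun [set: 'rV[R]_n.+1] (@row_last n).
Proof. exact: measurable_coord. Qed.

Local Open Scope ereal_scope.

Section step.
Variable n : nat.
Variable m : {sigma_finite_measure set 'rV[R]_n -> \bar R}.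

Definition lebesgue_step : set 'rV[R]_n.+1 -> \bar R :=
  pushforward (m \x (@lebesgue_measure R)) (@row_rcons n).

Let step0 : lebesgue_step set0 = 0.
Proof. by rewrite /lebesgue_step /pushforward preimage_set0 measure0. Qed.

Let step_ge0 A : 0 <= lebesgue_step A.
Proof. by rewrite /lebesgue_step /pushforward; exact: measure_ge0. Qed.

Let mrcons (A : set 'rV[R]_n.+1) :
  measurable A -> measurable (@row_rcons n @^-1` A).
Proof.
by move=> mA; rewrite -[X in measurable X]setTI; exact: measurable_row_rcons.
Qed.

Let step_sigma_additive : semi_sigma_additive lebesgue_step.
Proof.
move=> F mF tF mUF; rewrite /lebesgue_step /pushforward preimage_bigcup.
apply: measure_semi_sigma_additive.
- by move=> k; exact: mrcons.
- apply/trivIsetP => /= i j _ _ ij; rewrite -preimage_setI.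
  by move/trivIsetP : tF => /(_ _ _ _ _ ij) ->//; rewrite preimage_set0.
- by rewrite -preimage_bigcup; exact: mrcons.
Qed.

HB.instance Definition _ := isMeasure.Build _ _ _
  lebesgue_step step0 step_ge0 step_sigma_additive.

Let step_sigma_finite : sigma_finite setT lebesgue_step.
Proof.
have /sigma_finiteP[F [TF ndF Foo]] := sigma_finiteT m.
have /sigma_finiteP[G [TG ndG Goo]] := sigma_finiteT (@lebesgue_measure R).
exists (fun k => (@row_init n @^-1` F k) `&` (@row_last n @^-1` G k)).
  apply/seteqP; split=> // x _.
  have [i _ Fi] : (\bigcup_i F i) (row_init x) by rewrite -TF.
  have [j _ Gj] : (\bigcup_i G i) (row_last x) by rewrite -TG.
  exists (maxn i j) => //; split.
  - by rewrite /preimage/=; move: (row_init x) Fi; exact/subsetPset/ndF/leq_maxl.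
  - by rewrite /preimage/=; move: (row_last x) Gj; exact/subsetPset/ndG/leq_maxr.
move=> k; have [mF Fk] := Foo k; have [mG Gk] := Goo k; split.
  apply: measurableI; rewrite -[X in measurable X]setTI.
  - exact: measurable_row_init.
  - exact: measurable_row_last.
rewrite /lebesgue_step /pushforward (_ : _ @^-1` _ = F k `*` G k).
  by rewrite product_measure1E// lte_mul_pinfty// ge0_fin_numE.
by apply/seteqP; split=> -[x t] /=; rewrite row_init_rcons row_last_rcons.
Qed.

HB.instance Definition _ := Measure_isSigmaFinite.Build _ _ _
  lebesgue_step step_sigma_finite.

End step.

(* R^0 gets the point mass; R^n.+1 gets the product of the measures on R^n and
   R.  See lebesgue_row_box for the value on boxes. *)
Fixpoint lebesgue_row n : {sigma_finite_measure set 'rV[R]_n -> \bar R} :=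
  match n with
  | 0 => dirac (0%R : 'rV[R]_0)
  | n'.+1 => lebesgue_step (lebesgue_row n')
  end.

Lemma lebesgue_row_box n (B : 'I_n -> set R) :
  (forall i, measurable (B i)) ->
  lebesgue_row n [set x | forall i, B i (x ord0 i)] =
  \prod_(i < n) lebesgue_measure (B i).
Proof.
elim: n B => [|n IH] B mB.
  by rewrite big_ord0 /= /dirac indicE mem_set// => -[].
rewrite (bigD1_ord ord_max)//= muleC -IH; last by move=> i; exact: mB.
set C := [set x : 'rV[R]_n | forall i, B (lift ord_max i) (x ord0 i)].
have mC : measurable C.
  rewrite (_ : C = \bigcap_(i in [set: 'I_n])
      (fun x : 'rV[R]_n => x ord0 i) @^-1` B (lift ord_max i)).
    apply: fin_bigcap_measurable => // i _; rewrite -[X in measurable X]setTI.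
    exact: measurable_coord.
  by apply/seteqP; split=> x /= Cx; [move=> i _; exact: Cx|move=> i; exact: Cx].
rewrite -product_measure1E; [|exact: mC|exact: mB].
rewrite /= /lebesgue_step /pushforward; congr (product_measure1 _ _ _).
apply/seteqP; split=> -[x t] /=.
- move=> Bx; split=> [i|].
  + by have := Bx (lift ord_max i); rewrite mxE liftK.
  + by have := Bx ord_max; rewrite mxE unlift_none.
- move=> [Cx Bt] i; rewrite mxE.
  by case: unliftP => [j|] ->.
Qed.

End lebesgue_row.

Section euclidean.
Context {R : realType}.

(* The library's norm on row vectors is the sup norm, so the Euclidean norm is
   needed wherever metric quantities occur.  The topology and the bounded sets
   are the same for both. *)
Definition enorm n (x : 'rV[R]_n) : R := Num.sqrt (\sum_(i < n) x ord0 i ^+ 2).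

Definition eball n (z : 'rV[R]_n) (r : R) : set 'rV[R]_n :=
  [set x | enorm (x - z) < r].

Definition elipschitz n (L : R) (phi : 'rV[R]_n -> R) : Prop :=
  forall x y, `|phi x - phi y| <= L * enorm (x - y).

Definition epigraph n (phi : 'rV[R]_n -> R) : set 'rV[R]_n.+1 :=
  [set x | phi (row_init x) < row_last x].

Definition domain n (U : set 'rV[R]_n) : Prop :=
  [/\ U !=set0, connected U & open U].

Definition lipschitz_domain n (U : set 'rV[R]_n.+1) : Prop :=
  [/\ domain U, bounded_set U &
   exists r0 LipU : R, 0 < r0 /\
   forall z, (closure U `\` interior U) z ->
   exists (L : {linear 'rV[R]_n.+1 -> 'rV[R]_n.+1}) (phi : 'rV[R]_n -> R),
   [/\ forall x, enorm (L x) = enorm x,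
       elipschitz LipU phi &
       L @` U `&` eball (L z) r0 = epigraph phi `&` eball (L z) r0]].

(* Partial derivatives of all orders: smooth means that they all exist and are
   continuous. *)
Definition iter_partial n (f : 'rV[R]_n -> R) (s : seq 'I_n) : 'rV[R]_n -> R :=
  foldr (fun i g x => 'D_(delta_mx ord0 i) g x) f s.

Definition smooth n (f : 'rV[R]_n -> R) : Prop :=
  forall s : seq 'I_n,
    continuous (iter_partial f s) /\
    forall i x, derivable (iter_partial f s) x (delta_mx ord0 i).

(* C_c^infty(D), whose elements are extended by 0 outside D. *)
Definition test_function n (D : set 'rV[R]_n) (f : 'rV[R]_n -> R) : Prop :=
  let supp := closure [set x | f x != 0] in
  [/\ smooth f, compact supp & supp `<=` D].

End euclidean.

Section orlicz.
Context {R : realType}.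

(* An N-function lives on [0, +oo[; the values of A on negative numbers are
   irrelevant. *)
Definition N_function (A : R -> R) : Prop :=
  [/\ forall t, 0 <= t -> 0 <= A t,
      {within `[0, +oo[, continuous A},
      convex_function (`[0, +oo[%classic : set R) A,
      A t / t @[t --> 0^'+] --> 0 &
      A t / t @[t --> +oo] --> +oo].

Definition Delta2 (A : R -> R) : Prop :=
  exists2 p, 0 < p & forall t, 0 < t -> A (2 * t) <= p * A t.

(* alpha_{s,A}(l), for l > 0. *)
Definition orlicz_alpha (s : R) (A : R -> R) (l : R) : \bar R :=
  ereal_sup [set (A (l * t) / (l `^ s^-1 * A t))%:E | t in [set t | 0 < t]].

(* Meaningful for D a proper subset: inf set0 is 0 in the library. *)
Definition dist_compl n (D : set 'rV[R]_n) (x : 'rV[R]_n) : R :=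
  inf [set enorm (x - y) | y in ~` D].

(* The integrand is 0 on the (negligible) diagonal because 0^-1 = 0. *)
Definition orlicz_energy n (s : R) (A : R -> R) (D : set 'rV[R]_n)
    (f : 'rV[R]_n -> R) : \bar R :=
  (\int[lebesgue_row n \x lebesgue_row n]_(z in D `*` D)
    (A (`|f z.1 - f z.2| / enorm (z.1 - z.2) `^ s)
       / enorm (z.1 - z.2) ^+ n)%:E)%E.

Definition orlicz_hardy n (s : R) (A : R -> R) (D : set 'rV[R]_n)
    (f : 'rV[R]_n -> R) : \bar R :=
  (\int[lebesgue_row n]_(x in D) (A (`|f x| / dist_compl D x `^ s))%:E)%E.

(* The quotient is the extended real one.  For f != 0, A > 0 on ]0, +oo[ and D a
   proper open set, the denominator is positive and finite. *)
Definition hardy_constant n (s : R) (A : R -> R) (D : set 'rV[R]_n) : \bar R :=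
  ereal_inf [set (orlicz_energy s A D f / orlicz_hardy s A D f)%E |
    f in [set f | test_function D f /\ exists x, f x != 0]].

Definition FOHI n (s : R) (A : R -> R) (D : set 'rV[R]_n) : Prop :=
  (0 < hardy_constant s A D)%E.

End orlicz.

(* Main.v *)
Require Import Defs.
From mathcomp Require Import all_boot all_order all_algebra.
From mathcomp Require Import all_classical all_reals all_analysis.
From mathcomp Require Import measurable_realfun ring lra.

Set Implicit Arguments.
Unset Strict Implicit.
Unset Printing Implicit Defensive.

Import Order.TTheory GRing.Theory Num.Theory.
Import numFieldNormedType.Exports.

Local Open Scope classical_set_scope.
Local Open Scope ring_scope.

(** Write delta for the distance to the complement of D, H(f) for the Hardy
    integral of A(|f| / delta^s) over D, and E(f) for the energy.  Since H(f) is
    finite for a test function, it suffices to prove H(f) <= C E(f) + H(f) / 2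
    with C independent of f.

    For a fixed scale lam > 0 each point x is compared with an average over
    points y such that delta y is of order lam delta x and |x - y| is at most a
    constant times delta x.  By convexity and doubling,
      A(|f x| / delta(x)^s) <= C A(|f x - f y| / |x - y|^s)
                               + C0 A(lam^s |f y| / delta(y)^s).
    Averaged in y and integrated in x, the first term is at most a constant,
    depending on lam, times E(f).  In the second term the growth function
    yields A(lam^s t) <= alpha(lam^s) lam A(t), and exchanging the order of
    integration leaves the ratio between the volume of the points x which use a
    given y and the volume of the points y used by a given x.  If this ratio is
    right, the second term is a constant independent of lam times
    alpha(lam^s) H(f), or the weighted variant lam^(1 - N) alpha(lam^s) H(f), and
    a suitable lam makes it smaller than H(f) / 2 ([hardy_transfer],
    [FOHI_of_cover]).

    The geometry enters only through the two volumes.  Close to a Lipschitz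
    boundary y ranges over the slab between the heights lam h and 2 lam h over a
    cube of side max(1, lam) h, where h is the height of x above the graph; the
    points x using a given y lie in a layer of thickness delta(y) / lam, and the
    factor is alpha(lam^s) for every lam ([absorbed_chart]).  For an epigraph one
    chart covers D, which settles that case.  If both sets are merely compared
    with balls, the factor is lam^(1 - N) alpha(lam^s).  This happens for inward
    moves, lam <= 1, in every open set ([absorbed_inward]), and for outward
    moves, lam >= 1, from points at distance bounded below from a compact
    complement ([absorbed_outward]).  In an exterior domain the conditions
    allow respectively: an inward move close to the boundary combined with an
    outward move far from it; inward moves everywhere; outward moves everywhere,
    where points close to the boundary either stay in their chart or jump to a
    reference ray ([absorbed_near_outward]).

    Charts are only defined up to linear isometries, hence the invariance of
    Lebesgue measure under isometries, which follows from translation invariance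
    and Tonelli's theorem ([lebesgue_row_isometry]). *)

(** * The Euclidean norm *)

Section enorm_theory.
Context {R : realType} {n : nat}.
Implicit Types x y z : 'rV[R]_n.

Let sumsq x := \sum_(i < n) x ord0 i ^+ 2.

Let sumsq_ge0 x : 0 <= sumsq x.
Proof. by apply: sumr_ge0 => i _; exact: sqr_ge0. Qed.

Lemma enorm_ge0 x : 0 <= enorm x.
Proof. exact: sqrtr_ge0. Qed.

Lemma sqr_enorm x : enorm x ^+ 2 = \sum_(i < n) x ord0 i ^+ 2.
Proof. by rewrite sqr_sqrtr//; exact: sumsq_ge0. Qed.

Lemma enorm0 : enorm (0 : 'rV[R]_n) = 0.
Proof.
rewrite /enorm big1 ?sqrtr0// => i _.
by rewrite mxE expr0n.
Qed.

Lemma enormZ a x : enorm (a *: x) = `|a| * enorm x.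
Proof.
rewrite /enorm (eq_bigr (fun i => a ^+ 2 * x ord0 i ^+ 2)).
  by rewrite -mulr_sumr sqrtrM ?sqr_ge0// sqrtr_sqr.
by move=> i _; rewrite mxE exprMn.
Qed.

Lemma enormN x : enorm (- x) = enorm x.
Proof. by rewrite -scaleN1r enormZ normrN1 mul1r. Qed.

Lemma enormBC x y : enorm (x - y) = enorm (y - x).
Proof. by rewrite -enormN opprB. Qed.

Lemma coord_le_enorm x i : `|x ord0 i| <= enorm x.
Proof.
rewrite -sqrtr_sqr ler_sqrt ?sumsq_ge0//.
rewrite (bigD1 i)//= lerDl; apply: sumr_ge0 => j _; exact: sqr_ge0.
Qed.

Lemma enorm_eq0 x : enorm x = 0 -> x = 0.
Proof.
move=> x0; apply/rowP => i; rewrite mxE; apply/eqP.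
by rewrite -normr_le0 -x0 coord_le_enorm.
Qed.

(** With a = enorm x and b = enorm y, each coordinate satisfies
    (x_i + y_i)^2 <= (1 + b/a) x_i^2 + (1 + a/b) y_i^2; summing gives
    (a + b)^2, without the Cauchy-Schwarz inequality. *)
Lemma ler_enormD x y : enorm (x + y) <= enorm x + enorm y.
Proof.
have [x0|x0] := eqVneq (enorm x) 0.
  by rewrite x0 (enorm_eq0 x0) !add0r.
have [y0|y0] := eqVneq (enorm y) 0.
  by rewrite y0 (enorm_eq0 y0) !addr0.
set a := enorm x in x0 *; set b := enorm y in y0 *.
have a0 : 0 < a by rewrite lt_def x0 enorm_ge0.
have b0 : 0 < b by rewrite lt_def y0 enorm_ge0.
rewrite -(@ler_pXn2r _ 2) ?nnegrE ?addr_ge0 ?enorm_ge0//.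
rewrite sqr_enorm.
rewrite (_ : (a + b) ^+ 2 = (1 + b / a) * a ^+ 2 + (1 + a / b) * b ^+ 2);
  last by field; rewrite x0 y0.
rewrite {2}/a {3}/b !sqr_enorm !mulr_sumr -big_split/=.
apply: ler_sum => i _; rewrite mxE -subr_ge0.
set u := x ord0 i; set v := y ord0 i.
rewrite (_ : _ - _ = (b * u - a * v) ^+ 2 / (a * b)); last first.
  by field; rewrite x0 y0.
by rewrite divr_ge0 ?sqr_ge0// mulr_ge0// ltW.
Qed.

Lemma ler_enormB x y z : enorm (x - z) <= enorm (x - y) + enorm (y - z).
Proof. by rewrite (le_trans _ (ler_enormD _ _))// addrA subrK. Qed.

Lemma enorm_le_sum x : enorm x <= \sum_(i < n) `|x ord0 i|.
Proof.
rewrite -(@ler_pXn2r _ 2) ?nnegrE ?enorm_ge0 ?sumr_ge0// sqr_enorm.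
elim: (index_enum _) => [|i r IH]; first by rewrite !big_nil expr0n.
rewrite !big_cons sqrrD real_normK ?num_real// -addrA lerD2l.
rewrite (le_trans IH)// lerDr mulrn_wge0// mulr_ge0// sumr_ge0//.
Qed.

End enorm_theory.

(** * Topology and measurability in the Euclidean norm *)

Section enorm_topology.
Context {R : realType} {n : nat}.
Implicit Types (x y z : 'rV[R]_n) (r : R) (O : set 'rV[R]_n).

Lemma norm_le_enorm x : `|x| <= enorm x.
Proof.
rewrite /Num.norm/= mx_normrE; apply: bigmax_le; first exact: enorm_ge0.
by move=> -[i j] _ /=; rewrite (ord1 i) coord_le_enorm.
Qed.

Lemma coord_le_norm x i : `|x ord0 i| <= `|x|.
Proof.
rewrite [leRHS]/Num.norm/= mx_normrE.
exact: (le_bigmax 0 (fun ij => `|x ij.1 ij.2|) (ord0, i)).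
Qed.

Lemma enorm_le_norm x : enorm x <= n%:R * `|x|.
Proof.
rewrite (le_trans (enorm_le_sum _))//.
rewrite (le_trans (ler_sum _ (fun i _ => coord_le_norm x i)))//.
by rewrite sumr_const card_ord mulr_natl.
Qed.

Lemma nbhs_eball x r : 0 < r -> nbhs x (eball x r).
Proof.
move=> r0; apply/nbhs_ballP; exists (r / n.+1%:R) => /=; first exact: divr_gt0.
move=> y /=; rewrite -ball_normE /= ltr_pdivlMr// => xy.
rewrite /eball/= enormBC (le_lt_trans (enorm_le_norm _))//.
by rewrite (le_lt_trans _ xy)// mulrC ler_wpM2l// ler_nat.
Qed.

Lemma nbhs_eballP x (P : set 'rV[R]_n) :
  nbhs x P -> exists2 r, 0 < r & eball x r `<=` P.
Proof.
move=> /nbhs_ballP[r /= r0 rP]; exists r => // y; rewrite /eball/= => xy.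
by apply: rP; rewrite -ball_normE /=; rewrite (le_lt_trans (norm_le_enorm _))// enormBC.
Qed.

Lemma open_eballP O :
  open O <-> forall x, O x -> exists2 r, 0 < r & eball x r `<=` O.
Proof.
split=> [oO x Ox|OP].
  by apply: nbhs_eballP; exact: open_nbhs_nbhs.
rewrite openE => x /OP[r r0 rO]; apply: filterS rO _; exact: nbhs_eball.
Qed.

Lemma open_eball x r : open (eball x r).
Proof.
apply/open_eballP => y xy; exists (r - enorm (y - x)); first by rewrite subr_gt0.
move=> z; rewrite /eball/= ltrBrDr => zy.
by rewrite (le_lt_trans (ler_enormB _ y _)).
Qed.

Lemma elipschitz_continuous L (g : 'rV[R]_n -> R) :
  elipschitz L g -> continuous g.
Proof.
move=> Lg x; apply/(@cvgrPdist_le _ _ _ _ (nbhs_filter x)) => e e0.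
have L1 : 0 < `|L| + 1 by rewrite ltr_wpDl.
have xe : nbhs x (eball x (e / (`|L| + 1))) by apply: nbhs_eball; exact: divr_gt0.
apply: (@filterS _ (nbhs x) _ _ _ _ xe) => y; rewrite /eball/= enormBC => xy.
rewrite (le_trans (Lg _ _))//.
rewrite (@le_trans _ _ ((`|L| + 1) * enorm (x - y)))//.
  by rewrite ler_wpM2r ?enorm_ge0// (le_trans (ler_norm _))// lerDl.
by rewrite -ler_pdivlMl// mulrC ltW.
Qed.

Lemma elipschitz_enorm z : elipschitz 1 (fun x => enorm (x - z)).
Proof.
move=> x y; rewrite mul1r ler_norml.
have := ler_enormB y x z; have := ler_enormB x y z; rewrite (enormBC y x) => u v.
by apply/andP; split; lra.
Qed.

(** Rational boxes form a countable base of the topology. *)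
Lemma open_measurable_row O : open O -> measurable O.
Proof.
move=> oO.
pose box (i : 'rV[rat]_n * nat) := [set x : 'rV[R]_n |
  forall j, `|x ord0 j - ratr (i.1 ord0 j)| < i.2.+1%:R^-1].
pose F (i : 'rV[rat]_n * nat) := if `[< box i `<=` O >] then box i else set0.
have -> : O = \bigcup_i F i.
  apply/seteqP; split=> [x Ox|x [i _]]; last first.
    by rewrite /F; case: asboolP => [bO|_ []//]; exact: bO.
  have /open_eballP/(_ _ Ox)[r r0 rO] := oO.
  have r1 : 0 < r / (2 * n.+1%:R) by rewrite divr_gt0// mulr_gt0.
  have [k kr] : exists k : nat, k.+1%:R^-1 < r / (2 * n.+1%:R).
    exists (Num.truncn (r / (2 * n.+1%:R))^-1).
    by rewrite invf_plt ?posrE// truncnS_gt.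
  have /choice[q qP] : forall j, exists q : rat,
      `|x ord0 j - ratr q| < k.+1%:R^-1.
    move=> j; have := @dense_rat R [set t | `|x ord0 j - t| < k.+1%:R^-1].
    case.
    - by exists (x ord0 j) => /=; rewrite subrr normr0 invr_gt0.
    - rewrite (_ : [set t | _] = ball (x ord0 j) k.+1%:R^-1)//.
      exact: ball_open.
    - by move=> t [/= xt [q _ qt]]; exists q; rewrite qt.
  exists (\row_j q j, k) => //.
  have bx : box (\row_j q j, k) x by move=> j /=; rewrite mxE.
  rewrite /F; case: asboolP => //; case => y yb; apply: rO.
  rewrite /eball/= (le_lt_trans (enorm_le_sum _))//.
  rewrite (@le_lt_trans _ _ (\sum_(j < n) (r / n.+1%:R)))//.
    apply: ler_sum => j _; rewrite !mxE.
    rewrite (le_trans (ler_distD (ratr (q j)) _ _))//.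
    have := yb j; rewrite /= mxE => yj; have qj := qP j.
    have -> : r / n.+1%:R = r / (2 * n.+1%:R) + r / (2 * n.+1%:R).
      have: n.+1%:R != 0 :> R by rewrite pnatr_eq0.
      by move: (n.+1%:R : R) => c c0; field.
    rewrite lerD// ?[`|ratr _ - _|]distrC; exact: ltW (lt_trans _ kr).
  rewrite sumr_const card_ord -mulrnAr -[X in _ < X]mulr1 ltr_pM2l//.
  by rewrite -mulr_natl ltr_pdivrMr// mul1r ltr_nat.
apply: countable_bigcupT_measurable => [|i].
  exact: countableP.
rewrite /F; case: asboolP => // _.
rewrite (_ : box i = \bigcap_(j in [set: 'I_n])
    (fun x : 'rV[R]_n => x ord0 j) @^-1`
    ball (ratr (i.1 ord0 j) : R) i.2.+1%:R^-1); last first.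
  apply/seteqP; split => [x xb j _|x xb j] /=; last have := xb j Logic.I.
    by rewrite /ball/= distrC.
  by rewrite /preimage/ball/= distrC.
apply: fin_bigcap_measurable => // j _; rewrite -[X in measurable X]setTI.
apply: measurable_coord => //; apply: measurable_realfun.open_measurable; exact: ball_open.
Qed.

Lemma continuous_measurable_row (g : 'rV[R]_n -> R) :
  continuous g -> measurable_fun setT g.
Proof.
move=> cg; apply: (measurability (@measurable_realfun.RGenOpens.G R)).
  exact: measurable_realfun.RGenOpens.measurableE.
move=> _ [_ [a [b ->] <-]]; rewrite setTI; apply: open_measurable_row.
by apply: open_comp => // x _; exact: cg.
Qed.

End enorm_topology.

(** * Invariance of Lebesgue measure *)

Section image_measure.
Local Open Scope ereal_scope.
Context d1 d2 (T1 : measurableType d1) (T2 : measurableType d2) (R : realType).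
Variables (m : {measure set T1 -> \bar R}) (g : T1 -> T2).
Hypothesis mg : measurable_fun setT g.

Definition image_measure : {measure set T2 -> \bar R} :=
  measure_function_pushforward__canonical__measure_function_Measure m mg.

Lemma image_measureE A : image_measure A = m (g @^-1` A).
Proof. by []. Qed.

Lemma integral_measure_preserving (m' : {measure set T2 -> \bar R})
    (f : T2 -> \bar R) :
  (forall A, measurable A -> m (g @^-1` A) = m' A) ->
  measurable_fun setT f -> (forall x, 0 <= f x) ->
  \int[m]_x f (g x) = \int[m']_x f x.
Proof.
move=> mm' mf f0.
rewrite -(@eq_measure_integral _ _ _ setT m' image_measure f).
  rewrite [RHS]ge0_integral_pushforward//.
by move=> A mA _; rewrite image_measureE mm'.
Qed.
End image_measure.

Section invariance.
Context {R : realType}.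
Local Open Scope ereal_scope.

Lemma lebesgue_measure_translation (a : R) (A : set R) : measurable A ->
  lebesgue_measure [set t | A (t + a)%R] = lebesgue_measure A.
Proof.
move=> mA; pose f (t : measurableTypeR R) : measurableTypeR R := (t + a)%R.
have mf : measurable_fun setT f by apply: measurable_funD.
apply/esym; have := @lebesgue_measure_unique R (image_measure lebesgue_measure mf).
move/(_ _ A mA) => -> // X [[u v] _ <-] /=.
rewrite (_ : image_measure _ _ _ = lebesgue_measure (f @^-1` `]u, v]%classic))//.
rewrite (_ : f @^-1` _ = `](u - a)%R, (v - a)%R]%classic); last first.
  by apply/seteqP; split=> x; rewrite /f /= !in_itv/= ltrBlDr lerBrDr.
rewrite !lebesgue_measure_itv/= !lte_fin ltrD2r; case: ifP => // _.
by rewrite -!EFinB; congr EFin; ring.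
Qed.

Lemma measurable_row_translation n (v : 'rV[R]_n) :
  measurable_fun setT (fun x : 'rV[R]_n => x + v)%R.
Proof.
apply/measurable_fun_rowP => i; under eq_fun do rewrite mxE.
by apply: measurable_funD => //; exact: measurable_coord.
Qed.

(** The last coordinate of the slices moves by a translation of the line, and
    the measure of the slices is a function of the other coordinates, to which
    the induction hypothesis applies. *)
Lemma lebesgue_row_translation n (v : 'rV[R]_n) (A : set 'rV[R]_n) :
  measurable A -> lebesgue_row n [set x | A (x + v)%R] = lebesgue_row n A.
Proof.
elim: n v A => [|n IH] v A mA.
  by congr (lebesgue_row 0 _); apply/seteqP; split=> x /=; rewrite (thinmx0 v) addr0.
rewrite /= /lebesgue_step /pushforward /product_measure1.
set B := row_rcons (n:=n) @^-1` A.
have mB : measurable B.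
  by rewrite -[B]setTI; exact: measurable_row_rcons.
pose g (x : 'rV[R]_n) := lebesgue_measure (xsection B x).
transitivity (\int[lebesgue_row n]_x g (x + row_init v)%R); last first.
  apply: integral_measure_preserving => //.
  - exact: measurable_row_translation.
  - by move=> C mC; exact: IH.
  - exact: (@measurable_fun_xsection _ _ _ _ _ lebesgue_measure B).
apply: eq_integral => x _ /=.
rewrite /g -[RHS](lebesgue_measure_translation (row_last v)); last first.
  exact: measurable_xsection.
congr lebesgue_measure; apply/seteqP; split => t; rewrite /= /xsection/= !inE /B /=.
all: rewrite (_ : row_rcons (_ , _) + v = row_rcons (x + row_init v, t + row_last v))%R//.
all: apply/rowP => i; rewrite !mxE; case: unliftP => [j|] -> /=; rewrite ?mxE//.
Qed.

End invariance.

(** * Volumes of balls and cubes; isometries *)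

Section volumes.
Context {R : realType}.

Lemma measurable_set_ler d (X : measurableType d) (f g : X -> R) :
  measurable_fun setT f -> measurable_fun setT g ->
  measurable [set x | f x <= g x].
Proof.
move=> mf mg; have := measurable_fun_ler mf mg.
move=> /(_ measurableT [set true]); rewrite setTI; exact.
Qed.

Lemma measurable_set_ltr d (X : measurableType d) (f g : X -> R) :
  measurable_fun setT f -> measurable_fun setT g ->
  measurable [set x | f x < g x].
Proof.
move=> mf mg; have := measurable_fun_ltr mf mg.
move=> /(_ measurableT [set true]); rewrite setTI; exact.
Qed.

Lemma measurable_row_box n (B : 'I_n -> set R) :
  (forall i, measurable (B i)) ->
  measurable [set x : 'rV[R]_n | forall i, B i (x ord0 i)].
Proof.
move=> mB; rewrite (_ : [set x | _] = \bigcap_(i in [set: 'I_n])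
    (fun x : 'rV[R]_n => x ord0 i) @^-1` B i).
  apply: fin_bigcap_measurable => // i _; rewrite -[X in measurable X]setTI.
  exact: measurable_coord.
by apply/seteqP; split=> x /= Bx; [move=> i _|move=> i]; exact: Bx.
Qed.

Definition cube n (a : 'rV[R]_n) (s : R) : set 'rV[R]_n :=
  [set x | forall i, a ord0 i <= x ord0 i <= a ord0 i + s].

Lemma cubeE n (a : 'rV[R]_n) s :
  cube a s = [set x | forall i, `[a ord0 i, a ord0 i + s]%classic (x ord0 i)].
Proof. by apply/seteqP; split=> x + i => /(_ i); rewrite /= in_itv. Qed.

Lemma measurable_cube n (a : 'rV[R]_n) s : measurable (cube a s).
Proof.
rewrite cubeE.
by apply: (@measurable_row_box _ (fun i => `[a ord0 i, a ord0 i + s]%classic)).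
Qed.

Lemma lebesgue_row_cube n (a : 'rV[R]_n) s : 0 <= s ->
  lebesgue_row n (cube a s) = (s ^+ n)%:E.
Proof.
move=> s0; rewrite cubeE (@lebesgue_row_box _ _ (fun i => `[a ord0 i, a ord0 i + s]%classic))//.
rewrite (eq_bigr (fun=> s%:E)); last first.
  move=> i _; rewrite lebesgue_measure_itv/= lte_fin ltrDl -EFinB addrAC subrr add0r.
  by case: ltP => // s0'; congr EFin; apply/eqP; rewrite eq_le s0 s0'.
by rewrite prodEFin prodr_const card_ord.
Qed.

Lemma measurable_eball n (z : 'rV[R]_n) r : measurable (eball z r).
Proof. by apply: open_measurable_row; exact: open_eball. Qed.

Lemma measurable_closed_eball n (z : 'rV[R]_n) r :
  measurable [set x : 'rV[R]_n | enorm (x - z) <= r].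
Proof.
apply: measurable_set_ler => //; apply: continuous_measurable_row.
by apply: elipschitz_continuous; exact: elipschitz_enorm.
Qed.

Lemma lebesgue_closed_eball_le n (z : 'rV[R]_n) r : 0 <= r ->
  (lebesgue_row n [set x | (enorm (x - z) <= r)%R] <= ((2 * r) ^+ n)%:E)%E.
Proof.
move=> r0; rewrite -(@lebesgue_row_cube _ (z - const_mx r)) ?mulr_ge0//.
apply: le_measure; rewrite ?inE; [exact: measurable_closed_eball|exact: measurable_cube|].
move=> x /= xz i; have := coord_le_enorm (x - z) i; rewrite !mxE => h.
by move: (le_trans h xz); rewrite ler_norml => /andP[? ?]; apply/andP; split; lra.
Qed.

Lemma lebesgue_eball_ge n (z : 'rV[R]_n) r : 0 < r ->
  (((r / n.+1%:R) ^+ n)%:E <= lebesgue_row n (eball z r))%E.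
Proof.
move=> r0; rewrite -(@lebesgue_row_cube _ z); last by rewrite divr_ge0// ltW.
apply: le_measure; rewrite ?inE; [exact: measurable_cube|exact: measurable_eball|].
move=> x /= xz; rewrite /eball/= (le_lt_trans (enorm_le_sum _))//.
rewrite (@le_lt_trans _ _ (\sum_(j < n) (r / n.+1%:R)))//.
  apply: ler_sum => j _; rewrite !mxE.
  by have /andP[? ?] := xz j; rewrite ger0_norm ?subr_ge0// lerBlDl.
rewrite sumr_const card_ord -mulrnAr -[ltRHS]mulr1 ltr_pM2l//.
by rewrite -mulr_natl ltr_pdivrMr// mul1r ltr_nat.
Qed.

Section isometry.
Variables (n : nat) (T : 'rV[R]_n -> 'rV[R]_n).
Hypotheses (TD : forall x y, T (x + y) = T x + T y)
  (Tiso : forall x, enorm (T x) = enorm x)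
  (Tsurj : forall y, exists x, T x = y).

Lemma isometryN x : T (- x) = - T x.
Proof.
have T0 : T 0 = 0 by apply: (@addrI _ (T 0)); rewrite -TD !addr0.
by apply/eqP; rewrite -subr_eq0 opprK -TD addNr T0.
Qed.

Lemma isometryB x y : T (x - y) = T x - T y.
Proof. by rewrite TD isometryN. Qed.

Lemma measurable_isometry : measurable_fun setT T.
Proof.
apply/measurable_fun_rowP => i; apply: continuous_measurable_row.
apply: (@elipschitz_continuous _ _ 1) => x y; rewrite mul1r.
have := coord_le_enorm (T x - T y) i.
by rewrite !mxE -isometryB Tiso.
Qed.

Let preim_prod (g : 'rV[R]_n * 'rV[R]_n -> 'rV[R]_n) (A : set 'rV[R]_n) :
  measurable A ->
  (forall i, measurable_fun setT (fun z => g z ord0 i)) ->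
  measurable (g @^-1` A).
Proof.
move=> mA mg; rewrite -[X in measurable X]setTI.
by have /measurable_fun_rowP := mg; apply.
Qed.

Let mTfst i : measurable_fun setT
  (fun z : 'rV[R]_n * 'rV[R]_n => T z.1 ord0 i).
Proof.
apply: (measurableT_comp (measurable_coord i)).
by apply: (measurableT_comp measurable_isometry); exact: measurable_fst.
Qed.

Let msnd i : measurable_fun setT
  (fun z : 'rV[R]_n * 'rV[R]_n => z.2 ord0 i).
Proof. exact: (measurableT_comp (measurable_coord i) measurable_snd). Qed.

(** With C the unit ball and m the Lebesgue measure, both sides of
    m(C) m(T^-1 A) = m(A) m(C) are volumes of the sets
    {(x, y) | T x in A, y - T x in C} and {(x, y) | T x + y in A, - T x in C},
    whose sections at a given y are translates of each other. *)
Lemma lebesgue_row_isometry (A : set 'rV[R]_n) : measurable A ->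
  lebesgue_row n (T @^-1` A) = lebesgue_row n A.
Proof.
move=> mA; set m := lebesgue_row n; pose C := eball (0 : 'rV[R]_n) 1.
have mC : measurable C by exact: measurable_eball.
have mT := measurable_isometry.
have pT B : measurable B -> measurable (T @^-1` B).
  by move=> mB; rewrite -[X in measurable X]setTI; exact: mT.
pose E1 := [set z : 'rV[R]_n * 'rV[R]_n | A (T z.1) /\ C (z.2 - T z.1)].
pose E2 := [set z : 'rV[R]_n * 'rV[R]_n | A (T z.1 + z.2) /\ C (- T z.1)].
have mE1 : measurable E1.
  apply: measurableI.
    by apply: (@preim_prod (fun z => T z.1)).
  apply: (@preim_prod (fun z => z.2 - T z.1)) => // i.
  by under eq_fun do rewrite !mxE; apply: measurable_funB.
have mE2 : measurable E2.
  apply: measurableI.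
    apply: (@preim_prod (fun z => T z.1 + z.2)) => // i.
    by under eq_fun do rewrite !mxE; apply: measurable_funD.
  apply: (@preim_prod (fun z => - T z.1)) => // i.
  by under eq_fun do rewrite !mxE; apply: measurableT_comp.
have tonelli E : measurable E ->
    (\int[m]_x m (xsection E x) = \int[m]_y m (ysection E y))%E.
  move=> mE; have := @indic_fubini_tonelli _ _ _ _ R m m E mE.
  by rewrite indic_fubini_tonelli_FE// indic_fubini_tonelli_GE.
have : (\int[m]_x m (xsection E1 x) = \int[m]_x m (xsection E2 x))%E.
  rewrite (tonelli _ mE1) (tonelli _ mE2); apply: eq_integral => y _.
  have [v Tv] := Tsurj y.
  rewrite -[LHS](lebesgue_row_translation v); last exact: measurable_ysection.
  congr (lebesgue_row n _); apply/seteqP; split => x; rewrite /= /ysection/= !inE /E1 /E2/=.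
    by rewrite TD Tv [T x + y]addrC opprD addrA subrr add0r.
  by rewrite TD Tv [T x + y]addrC opprD addrA subrr add0r.
have mCT : m (T @^-1` C) = m C.
  by congr (lebesgue_row n _); apply/seteqP; split=> x; rewrite /C /eball/= !subr0 Tiso.
have -> : (\int[m]_x m (xsection E1 x) = m C * m (T @^-1` A))%E.
  transitivity (\int[m]_x (m C * (\1_(T @^-1` A) x)%:E))%E.
    apply: eq_integral => x _; rewrite indicE.
    case: (boolP (x \in T @^-1` A)); rewrite ?inE => Ax.
      rewrite mule1 -[RHS](lebesgue_row_translation (- T x))//.
      by congr (lebesgue_row n _); apply/seteqP; split=> y; rewrite /= /xsection/= !inE /E1 //= => -[].
    rewrite mule0 (_ : xsection _ _ = set0) ?measure0//.
    apply/seteqP; split => y //; rewrite /xsection/= inE /E1/= => -[Ax' _].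
    by move: Ax; rewrite notin_setE; apply.
  rewrite ge0_integralZl//; last first.
  - by apply: measurableT_comp => //; apply: measurable_indic; exact: pT.
  by rewrite integral_indic ?setIT//; exact: pT.
have -> : (\int[m]_x m (xsection E2 x) = m A * m C)%E.
  transitivity (\int[m]_x (m A * (\1_(T @^-1` C) x)%:E))%E.
    apply: eq_integral => x _; rewrite indicE.
    have CN : C (- T x) <-> C (T x) by rewrite /C /eball/= !subr0 enormN.
    case: (boolP (x \in T @^-1` C)); rewrite ?inE => Cx.
      rewrite mule1 -[RHS](lebesgue_row_translation (T x))//.
      congr (lebesgue_row n _); apply/seteqP; split=> y; rewrite /= /xsection/= !inE /E2 /= addrC.
        by case.
      by move=> Ay; split => //; apply/CN.
    rewrite mule0 (_ : xsection _ _ = set0) ?measure0//.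
    apply/seteqP; split => y //; rewrite /xsection/= inE /E2/= => -[_ /CN Ax'].
    by move: Cx; rewrite notin_setE; apply.
  rewrite ge0_integralZl//; last first.
  - by apply: measurableT_comp => //; apply: measurable_indic; exact: pT.
  rewrite integral_indic ?setIT//; last exact: (pT C mC).
  by rewrite -mCT.
have C0 : (0 < m C)%E.
  apply: (lt_le_trans _ (@lebesgue_eball_ge n 0 1 ltr01)).
  by rewrite lte_fin exprn_gt0// divr_gt0.
have Coo : (m C < +oo)%E.
  apply: (@le_lt_trans _ _ ((2 * 1) ^+ n)%:E); last exact: ltry.
  apply: le_trans (@lebesgue_closed_eball_le n 0 1 ler01).
  by apply: le_measure; rewrite ?inE; [exact: mC|exact: measurable_closed_eball|move=> x; exact: ltW].
rewrite [in RHS]muleC => /(congr1 (fun u => (m C)^-1 * u)%E).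
by rewrite !muleA mulVe ?gt0_fin_numE ?gt_eqF// !mul1e.
Qed.

End isometry.
End volumes.

(** * Graph coordinates *)

Section row_split.
Context {R : realType} {n : nat}.
Implicit Types x y : 'rV[R]_n.+1.

Lemma row_initD x y : row_init (x + y) = row_init x + row_init y.
Proof. by apply/rowP => i; rewrite !mxE. Qed.

Lemma row_lastD x y : row_last (x + y) = row_last x + row_last y.
Proof. by rewrite /row_last mxE. Qed.

Lemma row_initN x : row_init (- x) = - row_init x.
Proof. by apply/rowP => i; rewrite !mxE. Qed.

Lemma row_lastN x : row_last (- x) = - row_last x.
Proof. by rewrite /row_last mxE. Qed.

Lemma enorm_split x : enorm x ^+ 2 = row_last x ^+ 2 + enorm (row_init x) ^+ 2.
Proof.
rewrite !sqr_enorm (bigD1_ord ord_max)//=; congr (_ + _).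
by apply: eq_bigr => i _; rewrite mxE.
Qed.

Lemma enorm_row_init x : enorm (row_init x) <= enorm x.
Proof.
rewrite -(@ler_pXn2r _ 2) ?nnegrE ?enorm_ge0// [leRHS]enorm_split.
by rewrite lerDr sqr_ge0.
Qed.

Lemma row_last_le_enorm x : `|row_last x| <= enorm x.
Proof. exact: coord_le_enorm. Qed.

Lemma enorm_le_split x : enorm x <= `|row_last x| + enorm (row_init x).
Proof.
rewrite -(@ler_pXn2r _ 2) ?nnegrE ?addr_ge0 ?enorm_ge0// enorm_split sqrrD.
rewrite real_normK ?num_real// lerD2r lerDl mulrn_wge0// mulr_ge0// enorm_ge0//.
Qed.

Definition flip_last x : 'rV[R]_n.+1 := row_rcons (row_init x, - row_last x).

Lemma row_init_flip x : row_init (flip_last x) = row_init x.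
Proof. exact: row_init_rcons. Qed.

Lemma row_last_flip x : row_last (flip_last x) = - row_last x.
Proof. exact: row_last_rcons. Qed.

Lemma row_split_inj x y : row_init x = row_init y -> row_last x = row_last y -> x = y.
Proof. by move=> xy xy'; rewrite -(row_rconsK x) -(row_rconsK y) xy xy'. Qed.

Lemma flip_lastD x y : flip_last (x + y) = flip_last x + flip_last y.
Proof.
apply: row_split_inj; first by rewrite row_initD !row_init_flip row_initD.
by rewrite row_lastD !row_last_flip row_lastD opprD.
Qed.

Lemma flip_lastK x : flip_last (flip_last x) = x.
Proof.
by apply: row_split_inj; rewrite ?row_init_flip// !row_last_flip opprK.
Qed.

Lemma enorm_flip_last x : enorm (flip_last x) = enorm x.
Proof.
apply/eqP; rewrite -(@eqrXn2 _ 2) ?enorm_ge0//.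
by rewrite !enorm_split row_init_flip row_last_flip sqrrN.
Qed.

Lemma linear_isometry_surj (L : {linear 'rV[R]_n.+1 -> 'rV[R]_n.+1}) :
  (forall x, enorm (L x) = enorm x) -> forall y, exists x, L x = y.
Proof.
move=> Liso y; set M := lin1_mx L.
have fM : row_free M.
  rewrite -kermx_eq0; apply/eqP/row_matrixP => i; rewrite row0.
  apply: enorm_eq0; rewrite -Liso -(mul_rV_lin1 L) -row_mul mulmx_ker row0.
  exact: enorm0.
exists (y *m invmx M); rewrite -(mul_rV_lin1 L) mulmxKV//.
by rewrite -row_free_unit.
Qed.

Definition slab (phi : 'rV[R]_n -> R) (a : 'rV[R]_n) (w b c : R) :
    set 'rV[R]_n.+1 :=
  [set x | cube a w (row_init x) /\ b <= row_last x - phi (row_init x) <= c].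

Lemma measurable_height (phi : 'rV[R]_n -> R) : continuous phi ->
  measurable_fun setT (fun x : 'rV[R]_n.+1 => row_last x - phi (row_init x)).
Proof.
move=> cphi; apply: measurable_funB; first exact: measurable_row_last.
apply: (measurableT_comp (continuous_measurable_row cphi)).
exact: measurable_row_init.
Qed.

Lemma measurable_slab (phi : 'rV[R]_n -> R) a w b c : continuous phi ->
  measurable (slab phi a w b c).
Proof.
move=> cphi; apply: measurableI.
  rewrite -[X in measurable X]setTI; apply: measurable_row_init => //.
  exact: measurable_cube.
have mh := measurable_height cphi.
have : measurable ([set x : 'rV[R]_n.+1 | b <= row_last x - phi (row_init x)] `&`
    [set x | row_last x - phi (row_init x) <= c]).
  by apply: measurableI; apply: measurable_set_ler.
congr measurable; apply/seteqP.
by split=> x /= => [[-> ->]|/andP[]].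
Qed.

(** Every vertical line over the base meets the slab in an interval of length
    c - b, wherever the graph is. *)
Lemma lebesgue_row_slab (phi : 'rV[R]_n -> R) a w b c :
  continuous phi -> 0 <= w -> b <= c ->
  lebesgue_row n.+1 (slab phi a w b c) = ((c - b) * w ^+ n)%:E.
Proof.
move=> cphi w0 bc; rewrite /= /lebesgue_step /pushforward /product_measure1.
transitivity (\int[lebesgue_row n]_x ((c - b)%:E * (\1_(cube a w) x)%:E))%E.
  apply: eq_integral => x _ /=; rewrite indicE.
  case: (boolP (x \in cube a w)); rewrite ?inE ?notin_setE => ax.
    rewrite mule1 (_ : xsection _ _ = `[b + phi x, c + phi x]%classic).
      rewrite lebesgue_measure_itv/= lte_fin ltrD2r -EFinB.
      case: ltP => [_|cb]; congr EFin; first by ring.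
      by apply/eqP; rewrite eq_sym subr_eq0 eq_le bc cb.
    apply/seteqP; split=> t; rewrite /xsection/= inE /slab/= row_init_rcons
      row_last_rcons in_itv/= lerBrDr lerBlDr; first by case.
    by move=> ->.
  rewrite mule0 (_ : xsection _ _ = set0) ?measure0//.
  apply/seteqP; split => t //; rewrite /xsection/= inE /slab/= row_init_rcons.
  by case.
rewrite ge0_integralZl//; last 2 first.
- by apply: measurableT_comp => //; apply: measurable_indic; exact: measurable_cube.
- by rewrite lee_fin subr_ge0.
rewrite integral_indic ?setIT//; last exact: measurable_cube.
by rewrite EFinM; congr (_ * _)%E; exact: lebesgue_row_cube.
Qed.

End row_split.

(** * N-functions *)

Section N_functions.
Context {R : realType}.
Variable A : R -> R.
Hypotheses (hN : N_function A) (hD : Delta2 A).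

Lemma N_function_ge0 t : 0 <= t -> 0 <= A t.
Proof. by case: hN => A0 _ _ _ _; exact: A0. Qed.

Lemma N_function_convex t x y : 0 <= t <= 1 -> 0 <= x -> 0 <= y ->
  A (t * x + (1 - t) * y) <= t * A x + (1 - t) * A y.
Proof.
case: hN => _ _ cA _ _ /andP[t0 t1] x0 y0.
have := cA (Itv01 t0 t1) x y; rewrite !inE /= !in_itv/= !andbT => /(_ x0 y0).
by rewrite !convRE.
Qed.

(** Convexity alone would allow A to jump at 0; continuity excludes it. *)
Lemma N_function0 : A 0 = 0.
Proof.
case: hN => _ /continuous_within_itvcyP[_ cA] _ A0 _.
have h : A t @[t --> 0^'+] --> (0 * 0 : R).
  have : (A t / t) * t @[t --> 0^'+] --> (0 * 0 : R).
    by apply: cvgM => //; exact: cvg_at_right_filter.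
  apply: cvg_trans; apply: near_eq_cvg; near=> t.
  by rewrite divfK// gt_eqF//; near: t; exact: nbhs_right_gt.
by have /cvg_unique := cA; move=> /(_ (@norm_hausdorff _ _) _ h) ->; rewrite mul0r.
Unshelve. all: end_near. Qed.

Lemma N_functionZ t x : 0 <= t <= 1 -> 0 <= x -> A (t * x) <= t * A x.
Proof.
move=> t01 x0; have := N_function_convex t01 x0 (lexx 0).
by rewrite mulr0 addr0 N_function0 mulr0 addr0.
Qed.

Lemma N_function_homo x y : 0 <= x -> x <= y -> A x <= A y.
Proof.
move=> x0 xy; have [y0|y0] := eqVneq y 0.
  by move: xy; rewrite y0 => xy; rewrite (_ : x = 0)//; apply/eqP; rewrite eq_le xy.
have {}y0 : 0 < y by rewrite lt_def y0 (le_trans x0).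
rewrite -[x in A x](divfK (lt0r_neq0 y0)).
have t1 : x / y <= 1 by rewrite ler_pdivrMr// mul1r.
have t0 : 0 <= x / y by rewrite divr_ge0// ltW.
rewrite (le_trans (N_functionZ _ (ltW y0))) ?t0//.
by rewrite ler_piMl// N_function_ge0// ltW.
Qed.

Lemma Delta2_iter c : 0 <= c ->
  exists2 P, 0 < P & forall t, 0 <= t -> A (c * t) <= P * A t.
Proof.
move=> c0; have [p p0 Ap] := hD.
have hk (k : nat) t : 0 <= t -> A (2 ^+ k * t) <= p ^+ k * A t.
  elim: k => [|k IH] t0; first by rewrite !expr0 !mul1r.
  move: t0; rewrite le_eqVlt => /predU1P[<-|t0].
    by rewrite mulr0 N_function0 mulr0.
  rewrite !exprS -!mulrA (le_trans (Ap _ _)) ?mulr_gt0 ?exprn_gt0//.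
  by rewrite ler_pM2l// IH// ltW.
exists (p ^+ (Num.truncn c).+1); first exact: exprn_gt0.
move=> t t0; rewrite (le_trans _ (hk _ _ t0))//; apply: N_function_homo.
  exact: mulr_ge0.
rewrite ler_wpM2r// ltW// (lt_le_trans (truncnS_gt c))//.
by rewrite -natrX ler_nat ltnW// ltn_expl.
Qed.

(** By doubling, a zero of A at some t > 0 would spread to all larger arguments,
    against the superlinear growth of A. *)
Lemma N_function_gt0 t : 0 < t -> 0 < A t.
Proof.
move=> t0; rewrite lt_def N_function_ge0 ?ltW// andbT; apply/eqP => At0.
case: hN => _ _ _ _ /cvgryPge/(_ 1) [M [_ hM]].
pose u := `|M| + 1 + t.
have u0 : 0 < u by rewrite ltr_wpDl// addr_ge0.
have [P P0 hP] := Delta2_iter (ltW (divr_gt0 u0 t0)).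
have := hP _ (ltW t0); rewrite At0 mulr0 divfK ?gt_eqF// => Au.
have : 1 <= A u / u.
  by apply: hM; rewrite /u -addrA (le_lt_trans (ler_norm _))// ltrDl addr_gt0.
by rewrite ler_pdivlMr// mul1r leNgt (le_lt_trans Au).
Qed.

Lemma N_functionD x y : 0 <= x -> 0 <= y ->
  A (x + y) <= A (2 * x) + A (2 * y).
Proof.
move=> x0 y0; have h2 : 0 <= (2^-1 : R) <= 1 by apply/andP; split; lra.
have := N_function_convex h2 (mulr_ge0 (ltW (ltr0Sn R 1)) x0)
  (mulr_ge0 (ltW (ltr0Sn R 1)) y0).
rewrite (_ : 2^-1 * (2 * x) + _ = x + y); last by field.
move=> /le_trans; apply.
have := N_function_ge0 (mulr_ge0 (ltW (ltr0Sn R 1)) x0).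
have := N_function_ge0 (mulr_ge0 (ltW (ltr0Sn R 1)) y0).
by rewrite -/(2%:R) => ? ?; lra.
Qed.

Lemma measurable_N_function d (X : measurableType d) (g : X -> R) :
  measurable_fun setT g -> (forall x, 0 <= g x) ->
  measurable_fun setT (fun x => A (g x)).
Proof.
move=> mg g0; case: hN => _ cA _ _ _.
have mA : measurable_fun (`[0%R, +oo[%classic : set R) A.
  exact: subspace_continuous_measurable_fun.
have gR : [set g x | x in setT] `<=` (`[0%R, +oo[%classic : set R).
  by move=> _ [x _ <-]; rewrite /= in_itv/= andbT.
exact: (measurable_comp _ gR mA mg).
Qed.

End N_functions.

Section growth.
Context {R : realType}.

Lemma limf_einf_eq0_lt (g : R -> \bar R) (F : set (set R)) (W : set R) (e : R) :
  limf_einf g F = 0%E -> F W -> 0 < e -> exists2 l, W l & (g l < e%:E)%E.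
Proof.
rewrite limf_einfE => gF FW e0.
have /ereal_inf_lt[_ [l Wl <-] gl] : (ereal_inf (g @` W) < e%:E)%E.
  apply: (@le_lt_trans _ _ 0%E); last by rewrite lte_fin.
  by rewrite -gF; apply: ereal_sup_ubound; exists W.
by exists l.
Qed.

Lemma orlicz_alpha_lt (s : R) A l (e : R) :
  (forall t, 0 < t -> 0 < A t) -> 0 < l ->
  (orlicz_alpha s A l < e%:E)%E ->
  forall t, 0 < t -> A (l * t) <= e * (l `^ s^-1) * A t.
Proof.
move=> A0 l0 al t t0.
have : ((A (l * t) / (l `^ s^-1 * A t))%:E <= e%:E)%E.
  apply: le_trans (ltW al); apply: ereal_sup_ubound; exists t => //.
rewrite lee_fin ler_pdivrMr ?mulrA// mulr_gt0 ?powR_gt0 ?A0//.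
Qed.

End growth.

(** * Distance to the complement *)

Section dist_compl.
Context {R : realType} {n : nat}.
Variable D : set 'rV[R]_n.
Hypotheses (oD : open D) (Dc0 : ~` D !=set0).
Let delta := dist_compl D.

Let dists x := [set enorm (x - y) | y in ~` D].

Let dists_neq0 x : dists x !=set0.
Proof. by have [y Dy] := Dc0; exists (enorm (x - y)), y. Qed.

Let dists_lb x : has_lbound (dists x).
Proof. by exists 0 => _ [y _ <-]; exact: enorm_ge0. Qed.

Lemma dist_compl_le x y : ~ D y -> delta x <= enorm (x - y).
Proof. by move=> Dy; apply: (ge_inf (dists_lb x)); exists y. Qed.

Lemma dist_compl_ge x r : (forall y, ~ D y -> r <= enorm (x - y)) -> r <= delta x.
Proof.
by move=> h; apply: (lb_le_inf (dists_neq0 x)) => _ [y Dy <-]; exact: h.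
Qed.

Lemma dist_compl_near x e : 0 < e -> exists2 y, ~ D y & enorm (x - y) < delta x + e.
Proof.
move=> e0; have [_ [y Dy <-] xy] := @inf_adherent _ _ e e0 (conj (dists_neq0 x) (dists_lb x)).
by exists y.
Qed.

Lemma dist_compl_ge0 x : 0 <= delta x.
Proof. by apply: dist_compl_ge => y _; exact: enorm_ge0. Qed.

Lemma dist_compl_gt0 x : D x -> 0 < delta x.
Proof.
move=> Dx; have /open_eballP/(_ _ Dx)[r r0 rD] := oD.
apply: (lt_le_trans r0); apply: dist_compl_ge => y Dy.
by rewrite leNgt; apply/negP => xy; apply: Dy; apply: rD; rewrite /eball/= enormBC.
Qed.

Lemma dist_compl_gt0P x : D x <-> 0 < delta x.
Proof.
split; first exact: dist_compl_gt0.
move=> d0; apply: contrapT => Dx; have := dist_compl_le x Dx.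
by rewrite subrr enorm0 leNgt d0.
Qed.

Lemma dist_compl_leD x y : delta x <= enorm (x - y) + delta y.
Proof.
rewrite -lerBlDl; apply: dist_compl_ge => z Dz.
by rewrite lerBlDl (le_trans (dist_compl_le x Dz))// ler_enormB.
Qed.

Lemma elipschitz_dist_compl : elipschitz 1 delta.
Proof.
move=> x y; rewrite mul1r ler_norml.
have := dist_compl_leD x y; have := dist_compl_leD y x; rewrite enormBC => u v.
by apply/andP; split; lra.
Qed.

Lemma measurable_dist_compl : measurable_fun setT delta.
Proof.
by apply: continuous_measurable_row; exact: elipschitz_continuous elipschitz_dist_compl.
Qed.

(** Moving from x towards an almost nearest point of the complement. *)
Lemma dist_compl_inward x t : D x -> 0 < t <= 1 -> exists y,
  [/\ t / 2 * delta x <= delta y, delta y <= 2 * t * delta x &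
      enorm (x - y) <= 2 * delta x].
Proof.
move=> Dx /andP[t0 t1]; have d0 := dist_compl_gt0 Dx.
have [|z Dz xz] := @dist_compl_near x (t / 2 * delta x).
  by rewrite mulr_gt0// divr_gt0.
have xy : x - (z + t *: (x - z)) = (1 - t) *: (x - z).
  by apply/rowP => i; rewrite !mxE; ring.
have yz : z + t *: (x - z) - z = t *: (x - z).
  by apply/rowP => i; rewrite !mxE; ring.
have t1' : 0 <= 1 - t by rewrite subr_ge0.
exists (z + t *: (x - z)).
have le_z := dist_compl_le (z + t *: (x - z)) Dz.
rewrite yz enormZ gtr0_norm// in le_z.
have le_x := dist_compl_leD x (z + t *: (x - z)).
rewrite xy enormZ ger0_norm// in le_x *.
have e0 := enorm_ge0 (x - z).
by split; nra.
Qed.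

End dist_compl.

(** * Transferring the Hardy integral along a kernel *)

Section transfer.
Context {R : realType} {N : nat}.
Variables (D : set 'rV[R]_N) (A : R -> R) (s : R).
Hypotheses (oD : open D) (Dc0 : ~` D !=set0) (hN : N_function A)
  (hD : Delta2 A) (s01 : 0 < s < 1).
Let delta := dist_compl D.
Let mu := lebesgue_row N : {sigma_finite_measure set 'rV[R]_N -> \bar R}.

Definition orlicz_hardy_on (G : set 'rV[R]_N) (f : 'rV[R]_N -> R) : \bar R :=
  (\int[lebesgue_row N]_(x in G) (A (`|f x| / dist_compl D x `^ s))%:E)%E.

(** The support of the averaging kernel.  The constant K has to be uniform in
    lam, whereas K1 may depend on it: the first enters the coefficient of the
    Hardy integral, the second only that of the energy. *)
Definition scaled_pairs (lam K K1 : R) : set ('rV[R]_N * 'rV[R]_N) :=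
  [set z | [/\ D z.1, D z.2, enorm (z.1 - z.2) <= K1 * dist_compl D z.1,
    lam * dist_compl D z.1 <= K * dist_compl D z.2 &
    dist_compl D z.2 <= K * lam * dist_compl D z.1]].

Lemma measurable_fun_invr_ge0 d (X : measurableType d) (g : X -> R) :
  measurable_fun setT g -> (forall x, 0 <= g x) ->
  measurable_fun setT (fun x => (g x)^-1).
Proof.
move=> mg g0; under eq_fun do rewrite -powR_inv1//.
exact: (measurableT_comp (@measurable_powR R (-1)) mg).
Qed.

Let mD : measurable D. Proof. exact: open_measurable_row. Qed.

Let mdelta : measurable_fun setT delta.
Proof. exact: measurable_dist_compl. Qed.

Let delta_ge0 x : 0 <= delta x. Proof. exact: dist_compl_ge0. Qed.

Let menormB : measurable_fun setT
  (fun z : 'rV[R]_N * 'rV[R]_N => enorm (z.1 - z.2)).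
Proof.
have -> : (fun z : 'rV[R]_N * 'rV[R]_N => enorm (z.1 - z.2)) =
    (@enorm R N \o (fun z => z.1 - z.2)) by [].
apply: measurableT_comp.
  apply: continuous_measurable_row; apply: (@elipschitz_continuous _ _ 1).
  by move=> x y; have := elipschitz_enorm 0 x y; rewrite !subr0.
apply/measurable_fun_rowP => i; under eq_fun do rewrite !mxE.
apply: measurable_funB.
  exact: (measurableT_comp (measurable_coord i) measurable_fst).
exact: (measurableT_comp (measurable_coord i) measurable_snd).
Qed.

Let measurable_fst_row (g : 'rV[R]_N -> R) : measurable_fun setT g ->
  measurable_fun setT (fun z : 'rV[R]_N * 'rV[R]_N => g z.1).
Proof. by move=> mg; exact: (measurableT_comp mg measurable_fst). Qed.

Let measurable_snd_row (g : 'rV[R]_N -> R) : measurable_fun setT g ->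
  measurable_fun setT (fun z : 'rV[R]_N * 'rV[R]_N => g z.2).
Proof. by move=> mg; exact: (measurableT_comp mg measurable_snd). Qed.

Lemma measurable_scaled_pairs lam K K1 : measurable (scaled_pairs lam K K1).
Proof.
pose P := (fst @^-1` D `&` snd @^-1` D) `&`
  ([set z | enorm (z.1 - z.2) <= K1 * delta z.1] `&`
  ([set z | lam * delta z.1 <= K * delta z.2] `&`
   [set z | delta z.2 <= K * lam * delta z.1])) : set ('rV[R]_N * 'rV[R]_N).
have -> : scaled_pairs lam K K1 = P.
  by apply/seteqP; split=> z; [move=> []|move=> [[? ?] [? [? ?]]]].
have m1 := measurable_fst_row mdelta; have m2 := measurable_snd_row mdelta.
apply: measurableI; first apply: measurableI.
- by rewrite -[X in measurable X]setTI; exact: measurable_fst.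
- by rewrite -[X in measurable X]setTI; exact: measurable_snd.
apply: measurableI; last apply: measurableI.
- by apply: measurable_set_ler => //; exact: measurable_funM.
- by apply: measurable_set_ler => //; exact: measurable_funM.
- by apply: measurable_set_ler => //; exact: measurable_funM.
Qed.

Let s0 : 0 <= s. Proof. by case/andP: s01 => /ltW. Qed.

Let F (f : 'rV[R]_N -> R) x := `|f x| / delta x `^ s.
Let a (f : 'rV[R]_N -> R) x y := A (`|f x - f y| / enorm (x - y) `^ s).

Let F_ge0 f x : 0 <= F f x.
Proof. by rewrite divr_ge0// powR_ge0. Qed.

Lemma measurable_hardy_integrand f : measurable_fun setT f ->
  measurable_fun setT (fun x => A (F f x)).
Proof.
move=> mf; apply: measurable_N_function => //.
apply: measurable_funM; first exact: measurableT_comp.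
apply: measurable_fun_invr_ge0; last by move=> x; exact: powR_ge0.
exact: (measurableT_comp (@measurable_powR R s)).
Qed.

Lemma measurable_energy_integrand f : measurable_fun setT f ->
  measurable_fun setT (fun z : 'rV[R]_N * 'rV[R]_N =>
     a f z.1 z.2 / enorm (z.1 - z.2) ^+ N).
Proof.
move=> mf; apply: measurable_funM; last first.
  apply: measurable_fun_invr_ge0; last first.
    by move=> z; rewrite exprn_ge0// enorm_ge0.
  exact: measurable_funX.
apply: measurable_N_function => //; last first.
  by move=> z; rewrite divr_ge0// powR_ge0.
apply: measurable_funM.
  apply: measurableT_comp => //; apply: measurable_funB.
    exact: measurable_fst_row.
  exact: measurable_snd_row.
apply: measurable_fun_invr_ge0; last by move=> x; exact: powR_ge0.
exact: (measurableT_comp (@measurable_powR R s)).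
Qed.

Let invM_le (b c e : R) k : 0 < b -> 0 < e -> 0 <= c -> e <= c * b ->
  (b ^+ k)^-1 <= c ^+ k / e ^+ k.
Proof.
move=> b0 e0 c0 ecb; rewrite ler_pdivlMr ?exprn_gt0// mulrC.
rewrite ler_pdivrMr ?exprn_gt0// -exprMn lerXn2r// nnegrE ?mulr_ge0// ltW//.
Qed.

Let invpow_le (b c e : R) : 0 < b -> 0 < e -> 0 <= c -> e <= c * b ->
  (b `^ s)^-1 <= c `^ s / e `^ s.
Proof.
move=> b0 e0 c0 ecb; rewrite ler_pdivlMr ?powR_gt0// mulrC.
rewrite ler_pdivrMr ?powR_gt0// -powRM ?(ltW b0)//.
by rewrite ge0_ler_powR// nnegrE ?mulr_ge0// ltW.
Qed.

(** Pointwise, f x is compared with f y and f x - f y; on the diagonal the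
    difference vanishes, which is why the degenerate quotients are harmless. *)
Lemma hardy_pointwise f lam K K1 P0 P1 eps k x y :
  0 < lam -> 0 < K -> 0 < K1 -> 0 <= P0 -> 0 <= P1 ->
  (forall t, 0 <= t -> A (2 * K `^ s * t) <= P0 * A t) ->
  (forall t, 0 <= t -> A (2 * K1 `^ s * t) <= P1 * A t) ->
  (forall t, 0 <= t -> A (lam `^ s * t) <= eps * lam ^+ k * A t) ->
  scaled_pairs lam K K1 (x, y) ->
  A (F f x) / delta x ^+ N <=
    P1 * K1 ^+ N * (a f x y / enorm (x - y) ^+ N) +
    P0 * eps * lam ^+ k * (K * lam) ^+ N * (A (F f y) / delta y ^+ N).
Proof.
move=> lam0 K0 K10 P00 P10 hP0 hP1 hlam [/= Dx Dy xyK1 _ yx].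
have dx : 0 < delta x by exact: dist_compl_gt0.
have dy : 0 < delta y by exact: dist_compl_gt0.
have Kl0 : 0 < K * lam by exact: mulr_gt0.
pose d := `|f x - f y| / delta x `^ s; pose v := `|f y| / delta x `^ s.
have d0 : 0 <= d by rewrite divr_ge0// powR_ge0.
have v0 : 0 <= v by rewrite divr_ge0// powR_ge0.
have Fle : A (F f x) <= A (2 * d) + A (2 * v).
  rewrite (le_trans _ (N_functionD hN d0 v0))// N_function_homo//.
  rewrite -mulrDl ler_wpM2r// ?invr_ge0 ?powR_ge0//.
  by rewrite -{1}(subrK (f y) (f x)) ler_normD.
have dxN : 0 <= (delta x ^+ N)^-1 by rewrite invr_ge0 exprn_ge0.
apply: le_trans (ler_wpM2r dxN Fle) _; rewrite mulrDl; apply: lerD.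
- have [xy0|xy0] := eqVneq (enorm (x - y)) 0.
    have /eqP := enorm_eq0 xy0; rewrite subr_eq0 => /eqP xy.
    rewrite /d xy subrr normr0 mul0r mulr0 N_function0// mul0r.
    apply: mulr_ge0; first by rewrite mulr_ge0// exprn_ge0// ltW.
    apply: divr_ge0; last by rewrite exprn_ge0// enorm_ge0.
    by apply: N_function_ge0 => //; rewrite divr_ge0// powR_ge0.
  have {}xy0 : 0 < enorm (x - y) by rewrite lt_def xy0 enorm_ge0.
  have ad : A (2 * d) <= P1 * a f x y.
    have a0 : 0 <= `|f x - f y| / enorm (x - y) `^ s.
      by apply: divr_ge0; [exact: normr_ge0|exact: powR_ge0].
    apply: le_trans (hP1 _ a0).
    apply: N_function_homo => //; first by rewrite mulr_ge0.
    rewrite -mulrA ler_wpM2l// mulrCA ler_wpM2l//.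
    exact: invpow_le (ltW K10) xyK1.
  rewrite mulrACA; apply: ler_pM => //.
    by apply: N_function_ge0 => //; rewrite mulr_ge0.
  exact: invM_le (ltW K10) xyK1.
- have av : A (2 * v) <= P0 * eps * lam ^+ k * A (F f y).
    apply: (@le_trans _ _ (P0 * (eps * lam ^+ k * A (F f y)))); last first.
      by rewrite !mulrA.
    apply: le_trans (ler_wpM2l P00 (hlam _ (F_ge0 f y))).
    have lF0 : 0 <= lam `^ s * F f y by apply: mulr_ge0; [exact: powR_ge0|exact: F_ge0].
    apply: le_trans (hP0 _ lF0).
    apply: (N_function_homo hN); first by apply: mulr_ge0.
    rewrite -[leRHS]mulrA; apply: ler_wpM2l; first by [].
    rewrite [leRHS]mulrA -powRM; [|exact: ltW|exact: ltW].
    rewrite [leRHS]mulrCA; apply: ler_wpM2l; first exact: normr_ge0.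
    exact: invpow_le (ltW Kl0) yx.
  rewrite mulrACA; apply: ler_pM => //.
    by apply: N_function_ge0 => //; rewrite mulr_ge0.
  exact: invM_le (ltW Kl0) yx.
Qed.


Section kernel_estimate.
Variables (lam K K1 m B eps P0 P1 : R) (k : nat) (G : set 'rV[R]_N).
Variable f : 'rV[R]_N -> R.
Hypotheses (lam0 : 0 < lam) (K0 : 0 < K) (K10 : 0 < K1) (m0 : 0 < m)
  (B0 : 0 <= B) (eps0 : 0 <= eps) (P00 : 0 <= P0) (P10 : 0 <= P1)
  (hP0 : forall t, 0 <= t -> A (2 * K `^ s * t) <= P0 * A t)
  (hP1 : forall t, 0 <= t -> A (2 * K1 `^ s * t) <= P1 * A t)
  (hlam : forall t, 0 <= t -> A (lam `^ s * t) <= eps * lam ^+ k * A t)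
  (mG : measurable G) (GD : G `<=` D)
  (mf : measurable_fun setT f)
  (Qge : forall x, G x -> ((m * delta x ^+ N)%:E <=
    mu [set y | scaled_pairs lam K K1 (x, y)])%E)
  (Qle : forall y, D y ->
    (mu [set x | G x /\ scaled_pairs lam K K1 (x, y)] <=
     (B * m / lam ^+ (N + k) * delta y ^+ N)%:E)%E).

Let QG := scaled_pairs lam K K1 `&` fst @^-1` G.
Let e (z : 'rV[R]_N * 'rV[R]_N) :=
  \1_(D `*` D) z * (a f z.1 z.2 / enorm (z.1 - z.2) ^+ N).
Let g (z : 'rV[R]_N * 'rV[R]_N) :=
  \1_QG z * (A (F f z.1) / delta z.1 ^+ N / m).
Let h (z : 'rV[R]_N * 'rV[R]_N) := \1_QG z * (A (F f z.2) / delta z.2 ^+ N).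

Let mQG : measurable QG.
Proof.
apply: measurableI; first exact: measurable_scaled_pairs.
by rewrite -[X in measurable X]setTI; exact: measurable_fst.
Qed.

Let AF_ge0 x : 0 <= A (F f x) / delta x ^+ N.
Proof.
apply: divr_ge0; first exact: (N_function_ge0 hN (F_ge0 f x)).
exact: exprn_ge0.
Qed.

Let a_ge0 x y : 0 <= a f x y / enorm (x - y) ^+ N.
Proof.
apply: divr_ge0; last by rewrite exprn_ge0// enorm_ge0.
by apply: (N_function_ge0 hN); apply: divr_ge0; [exact: normr_ge0|exact: powR_ge0].
Qed.

Let mAF : measurable_fun setT (fun x => A (F f x) / delta x ^+ N).
Proof.
apply: measurable_funM; first exact: measurable_hardy_integrand.
apply: measurable_fun_invr_ge0; first exact: measurable_funX.
by move=> x; exact: exprn_ge0.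
Qed.

Let me : measurable_fun setT e.
Proof.
apply: measurable_funM; last exact: measurable_energy_integrand.
by apply: measurable_indic; exact: measurableX.
Qed.

Let mg : measurable_fun setT g.
Proof.
apply: measurable_funM; first exact: measurable_indic.
by apply: measurable_funM => //; exact: (measurable_fst_row mAF).
Qed.

Let mh : measurable_fun setT h.
Proof.
apply: measurable_funM; first exact: measurable_indic.
exact: (measurable_snd_row mAF).
Qed.

Let e_ge0 z : 0 <= e z.
Proof. by apply: mulr_ge0; [rewrite indicE ler0n|exact: a_ge0]. Qed.

Let g_ge0 z : 0 <= g z.
Proof.
apply: mulr_ge0; first by rewrite indicE ler0n.
by apply: divr_ge0; [exact: AF_ge0|exact: ltW].
Qed.

Let h_ge0 z : 0 <= h z.
Proof. by apply: mulr_ge0; [rewrite indicE ler0n|exact: AF_ge0]. Qed.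

Let c1 := P1 * K1 ^+ N / m.
Let c2 := P0 * eps * lam ^+ k * (K * lam) ^+ N / m.

Let c1_ge0 : 0 <= c1.
Proof. by rewrite divr_ge0 ?mulr_ge0 ?exprn_ge0// ltW. Qed.

Let c2_ge0 : 0 <= c2.
Proof.
apply: divr_ge0; last exact: ltW.
by do !apply: mulr_ge0 => //; apply: exprn_ge0; rewrite ltW// mulr_gt0.
Qed.

Let g_le z : g z <= c1 * e z + c2 * h z.
Proof.
rewrite /g /e /h; have [zQ|zQ] := boolP (z \in QG); last first.
  rewrite [\1_QG z]indicE (negbTE zQ) !mul0r mulr0 addr0.
  by apply: mulr_ge0; [exact: c1_ge0|exact: e_ge0].
have [Qz Gz] : QG z by rewrite inE in zQ.
have [Dx Dy _ _ _] := Qz.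
have DDz : z \in D `*` D by rewrite inE.
rewrite !indicE zQ DDz !mul1r.
rewrite ler_pdivrMr// mulrDl /c1 /c2 ![_ / m * _ * m]mulrAC !divfK ?gt_eqF//.
by move: Qz; rewrite {1}[z]surjective_pairing; exact: hardy_pointwise.
Qed.

Let hardy_le_kernel :
  (orlicz_hardy_on G f <= \int[mu]_x \int[mu]_y (g (x, y))%:E)%E.
Proof.
rewrite /orlicz_hardy_on integral_mkcond; apply: ge0_le_integral => //.
- move=> x _; rewrite patchE; case: ifP => // _; rewrite lee_fin.
  exact: (N_function_ge0 hN (F_ge0 f x)).
- apply/(measurable_restrictT _ _).1 => //; apply: measurable_funTS.
  by apply: measurableT_comp => //; exact: measurable_hardy_integrand.
- apply: (measurable_fun_fubini_tonelli_F (EFin \o g)).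
    exact: measurableT_comp.
  by move=> z; rewrite lee_fin.
move=> x _; rewrite patchE; case: ifPn => [|_]; last first.
  by apply: integral_ge0 => y _; rewrite lee_fin.
rewrite inE => Gx.
have dx : 0 < delta x by apply: dist_compl_gt0 => //; exact: GD.
set c := A (F f x) / delta x ^+ N / m.
have c0 : 0 <= c by apply: divr_ge0; [exact: AF_ge0|exact: ltW].
have mQx : measurable [set y | scaled_pairs lam K K1 (x, y)].
  by have := @measurable_xsection _ _ _ _ _ x (measurable_scaled_pairs lam K K1);
    rewrite xsectionE.
rewrite (_ : (\int[mu]_y _)%E =
    \int[mu]_y (c%:E * (\1_[set y | scaled_pairs lam K K1 (x, y)] y)%:E))%E.
  rewrite ge0_integralZl//; last by apply: measurableT_comp => //; exact: measurable_indic.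
  rewrite integral_indic// setIT.
  apply: (@le_trans _ _ (c%:E * (m * delta x ^+ N)%:E)%E).
    by rewrite -EFinM lee_fin /c mulrA divfK ?gt_eqF// divfK// gt_eqF// exprn_gt0.
  by apply: lee_pmul => //; [rewrite lee_fin mulr_ge0 ?exprn_ge0// ltW|exact: Qge].
apply: eq_integral => y _; rewrite -EFinM /g /= -/c mulrC; congr (_ * _)%:E.
rewrite !indicE; congr ((_ : bool)%:R); apply/idP/idP; rewrite !inE.
  by case.
by move=> Qxy; split.
Qed.

Let kernel_le_hardy : (\int[mu \x mu]_z (h z)%:E <=
  (B * m / lam ^+ (N + k))%:E * orlicz_hardy s A D f)%E.
Proof.
have mhE : measurable_fun setT (EFin \o h) by exact: measurableT_comp.
have h0 z : (0 <= (EFin \o h) z)%E by rewrite lee_fin.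
have Bm0 : 0 <= B * m / lam ^+ (N + k).
  apply: divr_ge0; first by apply: mulr_ge0 => //; exact: ltW.
  by apply: exprn_ge0; exact: ltW.
rewrite (fubini_tonelli2 _ mhE h0).
have mH : measurable_fun D (fun x => (A (F f x))%:E).
  apply: measurable_funTS; apply: measurableT_comp => //.
  exact: measurable_hardy_integrand.
have H0 x : D x -> (0 <= (A (F f x))%:E)%E.
  by move=> _; rewrite lee_fin; exact: (N_function_ge0 hN (F_ge0 f x)).
rewrite -ge0_integralZl// [leRHS]integral_mkcond.
apply: ge0_le_integral => //.
- by move=> y _; apply: integral_ge0.
- exact: (measurable_fun_fubini_tonelli_G (EFin \o h) mhE h0).
- by apply/(measurable_restrictT _ _).1 => //; exact: measurable_funeM.
move=> y _; rewrite patchE; case: ifPn => [|Dy]; last first.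
  rewrite /fubini_G (eq_integral (cst 0%E)) ?integral0// => x _.
  rewrite /= /h indicE (_ : (x, y) \in QG = false) ?mul0r//.
  by apply: contraNF Dy; rewrite !inE => -[[]].
rewrite inE => Dy.
have dy : 0 < delta y by exact: dist_compl_gt0.
set c := A (F f y) / delta y ^+ N.
have mQy : measurable [set x | G x /\ scaled_pairs lam K K1 (x, y)].
  have := @measurable_ysection _ _ _ _ _ y mQG; rewrite ysectionE.
  by congr measurable; apply/seteqP; split=> x [].
rewrite (_ : fubini_G _ _ _ = \int[mu]_x (c%:E *
    (\1_[set x | G x /\ scaled_pairs lam K K1 (x, y)] x)%:E))%E.
  rewrite ge0_integralZl//; last first.
  - exact: AF_ge0.
  - by apply: measurableT_comp => //; exact: measurable_indic.
  rewrite integral_indic// setIT.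
  apply: (@le_trans _ _ (c%:E * (B * m / lam ^+ (N + k) * delta y ^+ N)%:E)%E).
    by apply: lee_pmul => //; [exact: AF_ge0|exact: Qle].
  rewrite -!EFinM lee_fin /c mulrCA divfK//.
  by rewrite gt_eqF// exprn_gt0.
apply: eq_integral => x _; rewrite -EFinM /= /h /= -/c mulrC; congr (_ * _)%:E.
rewrite !indicE; congr ((_ : bool)%:R); apply/idP/idP; rewrite !inE.
  by case.
by case.
Qed.

(** The pointwise estimate is averaged over y and integrated over x.  Bounding
    the kernel in terms of |x - y| gives the energy; in the other term Tonelli's
    theorem reduces to Qle, which bounds the volume of the points x that use a
    given y. *)
Lemma hardy_on_le : (orlicz_hardy_on G f <=
  c1%:E * orlicz_energy s A D f +
  (P0 * K ^+ N * B * eps)%:E * orlicz_hardy s A D f)%E.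
Proof.
have mgE : measurable_fun setT (EFin \o g) by exact: measurableT_comp.
have g0E z : (0 <= (EFin \o g) z)%E by rewrite lee_fin.
have meE : measurable_fun setT (EFin \o e) by exact: measurableT_comp.
have mhE : measurable_fun setT (EFin \o h) by exact: measurableT_comp.
apply: (le_trans hardy_le_kernel).
rewrite -(fubini_tonelli1 _ mgE g0E).
apply: (@le_trans _ _ (\int[mu \x mu]_z
    (c1%:E * (e z)%:E + c2%:E * (h z)%:E))%E).
  apply: ge0_le_integral => //.
  - by apply: emeasurable_funD; apply: measurable_funeM.
  - by move=> z _; rewrite -!EFinM -EFinD lee_fin g_le.
rewrite ge0_integralD//; last first.
- exact: measurable_funeM.
- by move=> z _; rewrite -EFinM lee_fin mulr_ge0.
- exact: measurable_funeM.
- by move=> z _; rewrite -EFinM lee_fin mulr_ge0.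
rewrite !ge0_integralZl//; try by move=> z _; rewrite lee_fin.
apply: leeD.
  apply: lee_pmul => //; first by apply: integral_ge0 => z _; rewrite lee_fin.
  rewrite /orlicz_energy [leRHS]integral_mkcond le_eqVlt; apply/orP; left.
  apply/eqP; apply: eq_integral => z _.
  by rewrite patchE /e indicE; case: ifP; rewrite ?mul1r ?mul0r.
apply: (@le_trans _ _ (c2%:E * ((B * m / lam ^+ (N + k))%:E * orlicz_hardy s A D f))%E).
  apply: lee_pmul => //.
  by apply: integral_ge0 => z _; rewrite lee_fin.
rewrite muleA -EFinM le_eqVlt; apply/orP; left; apply/eqP.
congr ((_ : R)%:E * _)%E; rewrite /c2 exprMn exprD.
have lN : lam ^+ N != 0 by rewrite expf_neq0// gt_eqF.
have lk : lam ^+ k != 0 by rewrite expf_neq0// gt_eqF.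
move: (lam ^+ N) (lam ^+ k) (K ^+ N) lN lk => u v w u0 v0.
by field; rewrite u0 v0 gt_eqF.
Qed.

End kernel_estimate.

(** The constant in front of the Hardy integral depends on the geometry only
    through K and B, not on the scale lam. *)
Lemma hardy_transfer K B : 0 < K -> 0 <= B -> exists2 C0, 0 <= C0 &
  forall lam K1 m eps k G, 0 < lam -> 0 < K1 -> 0 < m -> 0 <= eps ->
  (forall t, 0 <= t -> A (lam `^ s * t) <= eps * lam ^+ k * A t) ->
  measurable G -> G `<=` D ->
  (forall x, G x -> ((m * dist_compl D x ^+ N)%:E <=
    lebesgue_row N [set y | scaled_pairs lam K K1 (x, y)])%E) ->
  (forall y, D y -> (lebesgue_row N [set x | G x /\ scaled_pairs lam K K1 (x, y)] <=
     (B * m / lam ^+ (N + k) * dist_compl D y ^+ N)%:E)%E) ->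
  exists2 C, 0 <= C & forall f, measurable_fun setT f ->
  (orlicz_hardy_on G f <= C%:E * orlicz_energy s A D f +
     (C0 * eps)%:E * orlicz_hardy s A D f)%E.
Proof.
move=> K0 B0.
have [|P0 P00 hP0] := Delta2_iter hN hD (c := 2 * K `^ s).
  by rewrite mulr_ge0// powR_ge0.
exists (P0 * K ^+ N * B).
  by rewrite !mulr_ge0// ?exprn_ge0// ltW.
move=> lam K1 m eps k G lam0 K10 m0 eps0 hlam mG GD Qge Qle.
have [|P1 P10 hP1] := Delta2_iter hN hD (c := 2 * K1 `^ s).
  by rewrite mulr_ge0// powR_ge0.
exists (P1 * K1 ^+ N / m) => [|f mf].
  by rewrite divr_ge0// ?mulr_ge0// ?exprn_ge0// ltW.
by apply: (@hardy_on_le lam K K1 m B eps P0 P1 k) => //; exact: ltW.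
Qed.

End transfer.

(** * Absorbing the Hardy integral over a part of the domain *)

Section absorption.
Context {R : realType} {n : nat}.
Variables (D : set 'rV[R]_n.+1) (A : R -> R) (s : R).
Hypotheses (oD : open D) (Dc0 : ~` D !=set0) (hN : N_function A)
  (hD : Delta2 A) (s01 : 0 < s < 1).
Let delta := dist_compl D.
Let mu := lebesgue_row n.+1 : {sigma_finite_measure set 'rV[R]_n.+1 -> \bar R}.

(** The constant C0 has to be uniform in lam, since lam is chosen last, to make
    C0 * eps small; eps measures how much smaller than lam ^+ k the growth factor
    of A at lam `^ s is. *)
Definition absorbed (k : nat) (I : set R) (G : R -> set 'rV[R]_n.+1) : Prop :=
  exists2 C0, 0 <= C0 & forall lam eps, 0 < lam -> I lam -> 0 <= eps ->
  (forall t, 0 <= t -> A (lam `^ s * t) <= eps * lam ^+ k * A t) ->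
  exists2 C, 0 <= C & forall f, measurable_fun setT f ->
  (orlicz_hardy_on D A s (G lam) f <= C%:E * orlicz_energy s A D f +
     (C0 * eps)%:E * orlicz_hardy s A D f)%E.

Lemma hardy_on_integrand_ge0 (f : 'rV[R]_n.+1 -> R) x : (0 <= (A (`|f x| / dist_compl D x `^ s))%:E)%E.
Proof.
rewrite lee_fin; apply: (N_function_ge0 hN); apply: divr_ge0 => //.
exact: powR_ge0.
Qed.

Lemma measurable_hardy_on_integrand (f : 'rV[R]_n.+1 -> R) (G : set 'rV[R]_n.+1) : measurable_fun setT f ->
  measurable_fun G (fun x => (A (`|f x| / dist_compl D x `^ s))%:E).
Proof.
move=> mf; apply: measurable_funTS; apply: measurableT_comp => //.
exact: measurable_hardy_integrand.
Qed.

Lemma orlicz_energy_ge0 (f : 'rV[R]_n.+1 -> R) : (0 <= orlicz_energy s A D f)%E.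
Proof.
apply: integral_ge0 => z _; rewrite lee_fin divr_ge0//.
  apply: (N_function_ge0 hN); apply: divr_ge0 => //; exact: powR_ge0.
by rewrite exprn_ge0// enorm_ge0.
Qed.

Lemma orlicz_hardy_ge0 (f : 'rV[R]_n.+1 -> R) : (0 <= orlicz_hardy s A D f)%E.
Proof. by apply: integral_ge0 => x _; exact: hardy_on_integrand_ge0. Qed.

Lemma orlicz_hardy_on_subset (f : 'rV[R]_n.+1 -> R) (G G' : set 'rV[R]_n.+1) :
  measurable_fun setT f -> measurable G -> measurable G' -> G `<=` G' ->
  (orlicz_hardy_on D A s G f <= orlicz_hardy_on D A s G' f)%E.
Proof.
move=> mf mG mG' GG'; apply: ge0_subset_integral => //.
  exact: measurable_hardy_on_integrand.
by move=> x _; exact: hardy_on_integrand_ge0.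
Qed.

Lemma orlicz_hardy_on_setU (f : 'rV[R]_n.+1 -> R) (G G' : set 'rV[R]_n.+1) :
  measurable_fun setT f -> measurable G -> measurable G' ->
  (orlicz_hardy_on D A s (G `|` G') f <=
   orlicz_hardy_on D A s G f + orlicz_hardy_on D A s G' f)%E.
Proof.
move=> mf mG mG'.
have -> : G `|` G' = G `|` (G' `\` G).
  apply/seteqP; split=> x [Gx|]; [by left| |by left|by case; right].
  by move=> G'x; have [Gx|Gx] := pselect (G x); [left|right].
have mGD : measurable (G' `\` G) by exact: measurableD.
have GG' : [disjoint G & G' `\` G] by apply/disj_setPS => x [Gx [_]].
have mfU := measurable_hardy_on_integrand (G := G `|` (G' `\` G)) mf.
rewrite {1}/orlicz_hardy_on (ge0_integral_setU _ mG mGD mfU _ GG'); last first.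
  by move=> x _; exact: hardy_on_integrand_ge0.
by apply: leeD => //; apply: orlicz_hardy_on_subset.
Qed.

Lemma absorbed_setU k I (G G' : R -> set 'rV[R]_n.+1) :
  (forall lam, I lam -> measurable (G lam) /\ measurable (G' lam)) ->
  absorbed k I G -> absorbed k I G' ->
  absorbed k I (fun lam => G lam `|` G' lam).
Proof.
move=> mGG' [C1 C10 h1] [C2 C20 h2]; exists (C1 + C2); first exact: addr_ge0.
move=> lam eps lam0 Ilam eps0 hlam.
have [C C_ge0 hC] := h1 _ _ lam0 Ilam eps0 hlam.
have [C' C'_ge0 hC'] := h2 _ _ lam0 Ilam eps0 hlam.
exists (C + C') => [|f mf]; first exact: addr_ge0.
have [mG mG'] := mGG' _ Ilam.
apply: (le_trans (orlicz_hardy_on_setU mf mG mG')).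
apply: (le_trans (leeD (hC f mf) (hC' f mf))).
rewrite mulrDl !EFinD !ge0_muleDl ?lee_fin ?mulr_ge0//.
by rewrite addeACA.
Qed.

Lemma absorbed_bigcup k I (T : eqType) (r : seq T)
    (G : T -> R -> set 'rV[R]_n.+1) :
  (forall i lam, i \in r -> I lam -> measurable (G i lam)) ->
  (forall i, i \in r -> absorbed k I (G i)) ->
  absorbed k I (fun lam => \big[setU/set0]_(i <- r) G i lam).
Proof.
elim: r => [|i r IH] mG h.
  exists 0 => // lam eps _ _ _ _; exists 0 => // f mf.
  by rewrite big_nil /orlicz_hardy_on integral_set0 mul0r !mul0e adde0.
have mr j lam : j \in r -> I lam -> measurable (G j lam).
  by move=> jr; apply: mG; rewrite inE jr orbT.
have {}IH : absorbed k I (fun lam => \big[setU/set0]_(i <- r) G i lam).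
  by apply: IH => // j jr; apply: h; rewrite inE jr orbT.
have := @absorbed_setU k I (G i) _ _ (h i (mem_head _ _)) IH.
move=> /(_ _)[|C0 C00 H].
  move=> lam Ilam; split; first by apply: mG => //; exact: mem_head.
  by rewrite big_seq; apply: bigsetU_measurable => j jr; exact: mr.
exists C0 => // lam eps l0 Il e0 hl; have [C C1 HC] := H lam eps l0 Il e0 hl.
by exists C => // f mf; rewrite big_cons; exact: HC.
Qed.

(** For lam >= 1, smallness relative to lam ^+ k weakens as k grows. *)
Lemma absorbed_exponent k l I G : (k <= l)%N -> I `<=` [set lam | 1 <= lam] ->
  absorbed l I G -> absorbed k I G.
Proof.
move=> kl I1 [C0 C00 h]; exists C0 => // lam eps lam0 Ilam eps0 hlam.
apply: (h _ _ lam0 Ilam eps0) => t t0; apply: (le_trans (hlam t t0)).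
rewrite ler_wpM2r ?N_function_ge0// ler_wpM2l//.
by apply: ler_weXn2l => //; exact: I1.
Qed.

Let measurable_xsec lam K K1 x :
  measurable [set y : 'rV[R]_n.+1 | scaled_pairs D lam K K1 (x, y)].
Proof.
have := @measurable_xsection _ _ _ _ _ x (measurable_scaled_pairs oD Dc0 lam K K1).
by rewrite xsectionE.
Qed.

Lemma measurable_scaled_preimage G lam K K1 y : measurable G ->
  measurable [set x : 'rV[R]_n.+1 | G x /\ scaled_pairs D lam K K1 (x, y)].
Proof.
move=> mG; apply: measurableI => //.
have := @measurable_ysection _ _ _ _ _ y (measurable_scaled_pairs oD Dc0 lam K K1).
by rewrite ysectionE.
Qed.

(** A point at distance comparable to lam * delta x brings a whole ball. *)
Lemma scaled_pairs_ball K lam x y0 : 0 < K -> 0 < lam -> D x ->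
  enorm (x - y0) <= K * Num.max 1 lam * delta x ->
  lam * delta x <= K * delta y0 -> delta y0 <= K * lam * delta x ->
  (((lam / (2 * K * n.+2%:R)) ^+ n.+1 * delta x ^+ n.+1)%:E <=
   mu [set y | scaled_pairs D lam (2 * K)%R (2 * K * Num.max 1 lam)%R (x, y)])%E.
Proof.
move=> K0 lam0 Dx xy0 xy1 xy2; have dx := dist_compl_gt0 oD Dc0 Dx.
have dy0 : 0 < delta y0.
  by rewrite -(@pmulr_rgt0 _ K)// (lt_le_trans _ xy1)// mulr_gt0.
have r0 : 0 < delta y0 / 2 by rewrite divr_gt0.
apply: (@le_trans _ _ (mu (eball y0 (delta y0 / 2)))); last first.
  apply: le_measure; rewrite ?inE; [exact: measurable_eball|exact: measurable_xsec|].
  move=> y; rewrite /eball/= => yy0.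
  have := dist_compl_leD Dc0 y y0; have := dist_compl_leD Dc0 y0 y.
  rewrite -/delta (enormBC y0) => le1 le2.
  have xy : enorm (x - y) <= enorm (x - y0) + enorm (y - y0).
    by rewrite (enormBC y) ler_enormB.
  have lM : lam <= Num.max 1 lam by rewrite le_max lexx orbT.
  have lM' : K * lam * delta x <= K * Num.max 1 lam * delta x.
    by rewrite ler_wpM2r ?(ltW dx)// ler_wpM2l// ltW.
  have dy : 0 < delta y by lra.
  split => //=; rewrite -/delta.
  - by apply/(dist_compl_gt0P oD Dc0).
  - by move: (Num.max 1 lam) lM' xy0 {lM} => M *; lra.
  - by nra.
  - by lra.
apply: le_trans (lebesgue_eball_ge _ r0); rewrite lee_fin -exprMn.
apply: lerXn2r; rewrite ?nnegrE.
- by rewrite mulr_ge0 ?(ltW dx)// divr_ge0 ?(ltW lam0)// !mulr_ge0// ltW.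
- by rewrite divr_ge0// ltW.
have n0 : 0 < n.+2%:R :> R by [].
move: (n.+2%:R : R) n0 => c c0.
rewrite [leLHS](_ : _ = lam * delta x / K / 2 / c); last first.
  by field; rewrite !gt_eqF.
apply: ler_wpM2r; first by rewrite invr_ge0 ltW.
by apply: ler_wpM2r => //; rewrite ler_pdivrMr// [leRHS]mulrC.
Qed.

(** An interior corkscrew condition at the scale lam * delta x, where the distance
    from x to the reference point is at most of the order of the larger of the two
    distances to the complement. *)
Definition corkscrew K lam (G : set 'rV[R]_n.+1) := forall x, G x ->
  exists y0, [/\ enorm (x - y0) <= K * Num.max 1 lam * delta x,
    lam * delta x <= K * delta y0 & delta y0 <= K * lam * delta x].

(** Both the set of possible y and the set of possible x are compared with
    balls; a ball of radius delta y / lam carries the factor lam ^- n.+1, which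
    is why the growth of A is measured against lam ^+ n.+1 here. *)
Lemma absorbed_ball K K2 I (G : R -> set 'rV[R]_n.+1) : 0 < K -> 0 <= K2 ->
  (forall lam, 0 < lam -> I lam ->
   [/\ measurable (G lam), G lam `<=` D, corkscrew K lam (G lam) &
    forall y, D y -> exists z, forall x, G lam x ->
      scaled_pairs D lam (2 * K) (2 * K * Num.max 1 lam) (x, y) ->
      enorm (x - z) <= K2 * delta y / lam]) ->
  absorbed n.+1 I G.
Proof.
move=> K0 K20 hG; have KK0 : 0 < 2 * K by rewrite mulr_gt0.
set c := 2 * K * n.+2%:R; have c0 : 0 < c by rewrite mulr_gt0.
pose B := (2 * K2) ^+ n.+1 * c ^+ n.+1.
have B0 : 0 <= B by rewrite mulr_ge0// exprn_ge0 ?mulr_ge0// ltW.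
have [C0 C00 hC] := hardy_transfer oD Dc0 hN hD s01 KK0 B0.
exists C0 => // lam eps lam0 Ilam eps0 hlam.
have [mG GD ck Gz] := hG lam lam0 Ilam.
have M0 : 0 < Num.max 1 lam by rewrite lt_max ltr01.
apply: (hC lam (2 * K * Num.max 1 lam) ((lam / c) ^+ n.+1) eps n.+1) => //.
- exact: mulr_gt0.
- by rewrite exprn_gt0// divr_gt0.
- move=> x Gx; have [y0 [h1 h2 h3]] := ck x Gx.
  by apply: (scaled_pairs_ball _ _ _ h1) => //; exact: GD.
move=> y Dy; have [z hz] := Gz y Dy; have dy := dist_compl_gt0 oD Dc0 Dy.
have r0 : 0 <= K2 * delta y / lam.
  by rewrite divr_ge0 ?mulr_ge0// ltW.
apply: (@le_trans _ _ ((2 * (K2 * delta y / lam)) ^+ n.+1)%:E).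
  apply: le_trans (lebesgue_closed_eball_le z r0).
  apply: le_measure; rewrite ?inE.
  - exact: measurable_scaled_preimage.
  - exact: measurable_closed_eball.
  - by move=> x [Gx Qx]; exact: hz.
rewrite lee_fin le_eqVlt; apply/orP; left; apply/eqP.
rewrite -/delta (_ : 2 * _ = 2 * K2 * delta y / lam); last by rewrite !mulrA.
rewrite /B exprD !expr_div_n [X in X / _ = _]exprMn.
have u0 : lam ^+ n.+1 != 0 by rewrite expf_neq0// gt_eqF.
have v0 : c ^+ n.+1 != 0 by rewrite expf_neq0// gt_eqF.
move: (lam ^+ n.+1) (c ^+ n.+1) ((2 * K2) ^+ n.+1) (delta y ^+ n.+1) u0 v0.
by move=> u v p q u0 v0; field; rewrite u0 v0.
Qed.

End absorption.

(** * From absorption to the Hardy inequality *)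

Section conclusion.
Context {R : realType} {n : nat}.
Variables (D : set 'rV[R]_n.+1) (A : R -> R) (s : R).
Hypotheses (oD : open D) (Dc0 : ~` D !=set0) (hN : N_function A)
  (hD : Delta2 A) (s01 : 0 < s < 1).
Let delta := dist_compl D.

Lemma ler_div_powR (a b c d r : R) : 0 <= a <= b -> 0 < c <= d -> 0 <= r ->
  a / d `^ r <= b / c `^ r.
Proof.
move=> /andP[a0 ab] /andP[c0 cd] r0.
have cr : 0 < c `^ r by exact: powR_gt0.
have crdr : c `^ r <= d `^ r.
  by apply: ge0_ler_powR; rewrite ?nnegrE ?(ltW c0)// (le_trans (ltW c0)).
move: (c `^ r) (d `^ r) cr crdr => u v u0 uv.
apply: ler_pM => //; first by rewrite invr_ge0 (le_trans _ uv)// ltW.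
by rewrite lef_pV2 ?posrE// (lt_le_trans u0).
Qed.

Lemma test_function_continuous (f : 'rV[R]_n.+1 -> R) :
  test_function D f -> continuous f.
Proof. by case=> /(_ [::])[]. Qed.

Lemma test_function_measurable (f : 'rV[R]_n.+1 -> R) :
  test_function D f -> measurable_fun setT f.
Proof.
by move=> tf; apply: continuous_measurable_row; exact: test_function_continuous.
Qed.

(** On the compact support of f, the integrand is bounded, because delta has a
    positive minimum there. *)
Lemma orlicz_hardy_fin (f : 'rV[R]_n.+1 -> R) :
  test_function D f -> (orlicz_hardy s A D f < +oo)%E.
Proof.
move=> tf; have cf := test_function_continuous tf.
have mf := test_function_measurable tf.
have [_] := tf; set S := closure _ => cS SD.
have Sout x : ~ S x -> f x = 0.
  move=> Sx; apply: contrapT => fx; apply: Sx; apply: subset_closure => /=.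
  exact/eqP.
have mS : measurable S.
  rewrite -[S]setCK; apply: measurableC; apply: open_measurable_row.
  by rewrite openC; exact: closed_closure.
have [S0|/set0P Sn0] := eqVneq S set0.
  rewrite /orlicz_hardy (eq_integral (cst 0%E)) ?integral0// => x _.
  rewrite Sout ?S0// normr0 mul0r (N_function0 hN)//.
have [xM _ hM] := EVT_max_rV Sn0 cS (continuous_subspaceT
  (fun x => continuous_comp (cf x) (@norm_continuous _ R (f x)))).
have cdelta := elipschitz_continuous (elipschitz_dist_compl Dc0).
have [xm xmS hm] := EVT_min_rV Sn0 cS (continuous_subspaceT cdelta).
have dm : 0 < delta xm by apply: (dist_compl_gt0 oD Dc0); apply: SD; rewrite inE in xmS.
set M := `|f xM| / delta xm `^ s.
have AM0 : 0 <= A M.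
  apply: (N_function_ge0 hN); apply: divr_ge0; [exact: normr_ge0|exact: powR_ge0].
have [B [_ hB]] := compact_bounded cS.
have B1 : forall x, S x -> enorm (x - 0) <= n.+1%:R * (`|B| + 1).
  move=> x Sx; rewrite subr0 (le_trans (enorm_le_norm _))// ler_wpM2l//.
  by apply: hB => //; rewrite (le_lt_trans (ler_norm _))// ltrDl.
have muS : (lebesgue_row n.+1 S < +oo)%E.
  apply: (@le_lt_trans _ _ ((2 * (n.+1%:R * (`|B| + 1))) ^+ n.+1)%:E); last exact: ltry.
  have r0 : 0 <= n.+1%:R * (`|B| + 1) by rewrite mulr_ge0// addr_ge0.
  apply: le_trans (@lebesgue_closed_eball_le _ n.+1 0 _ r0).
  by apply: le_measure; rewrite ?inE //; exact: measurable_closed_eball.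
apply: (@le_lt_trans _ _ (\int[lebesgue_row n.+1]_(x in D)
    ((A M)%:E * (\1_S x)%:E))%E).
  have mD := open_measurable_row oD.
  apply: ge0_le_integral.
  - exact: mD.
  - by move=> x _; exact: (hardy_on_integrand_ge0 D s hN f).
  - exact: (measurable_hardy_on_integrand s Dc0 hN mf).
  - apply: measurable_funTS; apply: measurable_funeM.
    by apply: measurableT_comp => //; exact: measurable_indic.
  move=> x _; rewrite indicE; case: (boolP (x \in S)) => [|Sx]; last first.
    rewrite mule0 Sout; last by move: Sx; rewrite notin_setE.
    by rewrite normr0 mul0r (N_function0 hN).
  rewrite inE => Sx; rewrite mule1 lee_fin; apply: (N_function_homo hN).
    by apply: divr_ge0; [exact: normr_ge0|exact: powR_ge0].
  have fM : `|f x| <= `|f xM| by apply: hM; rewrite inE.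
  have dmx : delta xm <= delta x by apply: hm; rewrite inE.
  by apply: ler_div_powR; [rewrite normr_ge0|rewrite dm|case/andP: s01 => /ltW].
have mD := open_measurable_row oD.
rewrite ge0_integralZl//; last first.
- by apply: measurable_funTS; apply: measurableT_comp => //; exact: measurable_indic.
rewrite integral_indic//.
rewrite (_ : S `&` D = S); last by apply/setIidPl.
by rewrite lte_mul_pinfty// lee_fin.
Qed.

(** By continuity f stays away from 0 on a ball contained in D.  Positivity
    matters because a quotient 0 / 0 of extended reals equals 0. *)
Lemma orlicz_hardy_gt0 (f : 'rV[R]_n.+1 -> R) x0 :
  test_function D f -> f x0 != 0 -> (0 < orlicz_hardy s A D f)%E.
Proof.
move=> tf fx0; have cf := test_function_continuous tf.
have mf := test_function_measurable tf.
have Dx0 : D x0 by case: tf => _ _; apply; exact: subset_closure.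
have f0 : 0 < `|f x0| / 2 by rewrite divr_gt0// normr_gt0.
have [r1 r10 r1D] : exists2 r, 0 < r & eball x0 r `<=` D.
  by have /open_eballP := oD; apply.
have [r2 r20 r2f] : exists2 r, 0 < r &
    eball x0 r `<=` [set x | `|f x0 - f x| <= `|f x0| / 2].
  by apply: nbhs_eballP; have /(@cvgrPdist_le _ _ _ _ (nbhs_filter x0)) := cf x0; exact.
pose r := Num.min r1 r2; have r0 : 0 < r by rewrite lt_min r10.
have rD : eball x0 r `<=` D.
  by move=> x xr; apply: r1D; rewrite /eball/= (lt_le_trans xr)// ge_min lexx.
have s0 : 0 <= s by case/andP: s01 => /ltW.
have dr : 0 < delta x0 + r by rewrite addr_gt0// dist_compl_gt0.
set c := `|f x0| / 2 / (delta x0 + r) `^ s.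
have c0 : 0 < c by rewrite divr_gt0// powR_gt0.
have Ac : 0 < A c by exact: (N_function_gt0 hN hD).
have mB := measurable_eball x0 r.
apply: (@lt_le_trans _ _ ((A c)%:E * lebesgue_row n.+1 (eball x0 r))%E).
  apply: mule_gt0; first by rewrite lte_fin.
  apply: (lt_le_trans _ (lebesgue_eball_ge x0 r0)).
  by rewrite lte_fin exprn_gt0// divr_gt0.
apply: (@le_trans _ _ (orlicz_hardy_on D A s (eball x0 r) f)); last first.
  by apply: orlicz_hardy_on_subset => //; exact: open_measurable_row.
rewrite -integral_cst//; apply: ge0_le_integral.
- exact: mB.
- by move=> x _; rewrite lee_fin ltW.
- by [].
- exact: (measurable_hardy_on_integrand s Dc0 hN mf).
move=> x xr; rewrite lee_fin; apply: (N_function_homo hN); first exact: ltW.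
have dx : 0 < delta x by apply: (dist_compl_gt0 oD Dc0); exact: rD.
apply: ler_div_powR; last exact: s0.
- rewrite (ltW f0) /=.
  have : `|f x0 - f x| <= `|f x0| / 2.
    by apply: r2f; rewrite /eball/= (lt_le_trans xr)// ge_min lexx orbT.
  have : `|f x0| <= `|f x0 - f x| + `|f x|.
    by rewrite -{1}(subrK (f x) (f x0)) ler_normD.
  by lra.
- rewrite dx /=; have := dist_compl_leD Dc0 x x0; rewrite -/delta => dxx0.
  by rewrite (le_trans dxx0)// addrC lerD2l; exact: ltW.
Qed.

Lemma FOHI_of_absorption C : 0 <= C ->
  (forall f, test_function D f -> (orlicz_hardy s A D f <=
     C%:E * orlicz_energy s A D f + (2^-1)%:E * orlicz_hardy s A D f)%E) ->
  FOHI s A D.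
Proof.
move=> C0 hC; have c0 : 0 < 2 * C + 1 by rewrite ltr_wpDl// mulr_ge0.
apply: (@lt_le_trans _ _ ((2 * C + 1)^-1)%:E); first by rewrite lte_fin invr_gt0.
apply/ereal_infP => _ [f [tf [x0 fx0]] <-].
have hoo := orlicz_hardy_fin tf; have h0 := orlicz_hardy_gt0 tf fx0.
have E0 := orlicz_energy_ge0 D s hN f.
move: (hC f tf) hoo h0 E0; case: (orlicz_hardy s A D f) => [h| |]// hh _.
rewrite lte_fin => h0; rewrite inver gt_eqF//.
move: hh; case: (orlicz_energy s A D f) => [e| |]//; last first.
  by move=> _ _; rewrite gt0_mulye ?lte_fin ?invr_gt0// leey.
rewrite -!EFinM -EFinD !lee_fin => hh e0.
by rewrite ler_pdivlMr// mulrC ler_pdivrMr//; lra.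
Qed.

(** The Hardy integral is finite, so it may be absorbed once the constants in
    front of it add up to at most one half. *)
Lemma FOHI_of_cover k1 k2 I1 I2 (G1 G2 : R -> set 'rV[R]_n.+1) :
  absorbed D A s k1 I1 G1 -> absorbed D A s k2 I2 G2 ->
  (forall eps, 0 < eps -> exists lam, [/\ 0 < lam, I1 lam &
    forall t, 0 <= t -> A (lam `^ s * t) <= eps * lam ^+ k1 * A t]) ->
  (forall eps, 0 < eps -> exists lam, [/\ 0 < lam, I2 lam &
    forall t, 0 <= t -> A (lam `^ s * t) <= eps * lam ^+ k2 * A t]) ->
  (forall lam, I1 lam -> measurable (G1 lam)) ->
  (forall lam, I2 lam -> measurable (G2 lam)) ->
  (forall lam1 lam2, I1 lam1 -> I2 lam2 -> D `<=` G1 lam1 `|` G2 lam2) ->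
  FOHI s A D.
Proof.
move=> [C1 C10 h1] [C2 C20 h2] small1 small2 mG1 mG2 cover.
have c0 : 0 < 2 * (C1 + C2 + 1) by rewrite mulr_gt0// ltr_wpDl// addr_ge0.
set eps := (2 * (C1 + C2 + 1))^-1.
have eps0 : 0 < eps by rewrite invr_gt0.
have [l1 [l10 Il1 hl1]] := small1 _ eps0.
have [l2 [l20 Il2 hl2]] := small2 _ eps0.
have [K1 K10 hK1] := h1 _ _ l10 Il1 (ltW eps0) hl1.
have [K2 K20 hK2] := h2 _ _ l20 Il2 (ltW eps0) hl2.
have ceps : C1 * eps + C2 * eps <= 2^-1.
  rewrite -mulrDl /eps invfM mulrCA ler_piMr ?invr_ge0//.
  by rewrite ler_pdivrMr ?mul1r ?lerDl// ltr_wpDl// addr_ge0.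
apply: (@FOHI_of_absorption (K1 + K2)) => [|f tf]; first exact: addr_ge0.
have mf := test_function_measurable tf.
have mD := open_measurable_row oD.
apply: (@le_trans _ _ (orlicz_hardy_on D A s (G1 l1 `|` G2 l2) f)).
  apply: orlicz_hardy_on_subset => //; last exact: cover.
  by apply: measurableU; [exact: mG1|exact: mG2].
apply: (le_trans (orlicz_hardy_on_setU s Dc0 hN mf (mG1 _ Il1) (mG2 _ Il2))).
apply: (le_trans (leeD (hK1 f mf) (hK2 f mf))).
have H0 := orlicz_hardy_ge0 D s hN f; have E0 := orlicz_energy_ge0 D s hN f.
rewrite addeACA -!ge0_muleDl ?lee_fin ?mulr_ge0 ?(ltW eps0)//.
by rewrite -!EFinD leeD2l// lee_wpmul2r// lee_fin.
Qed.

Lemma alpha_scale1 (W : set R) :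
  (forall e, 0 < e -> exists2 l, 0 < l /\ W l & (orlicz_alpha s A l < e%:E)%E) ->
  forall eps, 0 < eps -> exists lam, [/\ 0 < lam, W (lam `^ s) &
    forall t, 0 <= t -> A (lam `^ s * t) <= eps * lam ^+ 1 * A t].
Proof.
move=> small eps eps0; have [l [l0 Wl] al] := small _ eps0.
have s0 : s != 0 by case/andP: s01 => s0 _; rewrite gt_eqF.
have ls : (l `^ s^-1) `^ s = l by rewrite -powRrM mulVf// powRr1// ltW.
exists (l `^ s^-1); rewrite ls; split => //; first exact: powR_gt0.
move=> t; rewrite le_eqVlt => /predU1P[<-|t0].
  by rewrite !mulr0 (N_function0 hN) mulr0.
by rewrite expr1; apply: orlicz_alpha_lt => // u; exact: N_function_gt0.
Qed.

(** With lam = l^(1/s), the weight l^((1 - N)/s) turns the factor l^(1/s) = lam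
    of the growth function into lam^N. *)
Lemma alpha_scaleN (W : set R) :
  (forall e, 0 < e -> exists2 l, 0 < l /\ W l &
    ((l `^ ((1 - n.+1%:R) / s))%:E * orlicz_alpha s A l < e%:E)%E) ->
  forall eps, 0 < eps -> exists lam, [/\ 0 < lam, W (lam `^ s) &
    forall t, 0 <= t -> A (lam `^ s * t) <= eps * lam ^+ n.+1 * A t].
Proof.
move=> small eps eps0; have [l [l0 Wl] al] := small _ eps0.
have s0 : s != 0 by case/andP: s01 => s0 _; rewrite gt_eqF.
have ls : (l `^ s^-1) `^ s = l by rewrite -powRrM mulVf// powRr1// ltW.
exists (l `^ s^-1); rewrite ls; split => //; first exact: powR_gt0.
move=> t; rewrite le_eqVlt => /predU1P[<-|t0].
  by rewrite !mulr0 (N_function0 hN) mulr0.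
set w := l `^ _ in al; have w0 : 0 < w by exact: powR_gt0.
have {}al : (orlicz_alpha s A l < (eps / w)%:E)%E.
  by rewrite EFinM lte_pdivlMr// muleC.
have := orlicz_alpha_lt (N_function_gt0 hN hD) l0 al t0.
suff -> : eps / w * l `^ s^-1 = eps * (l `^ s^-1) ^+ n.+1 by [].
rewrite -mulrA; congr (_ * _).
rewrite -powR_mulrn ?powR_ge0// -powRrM /w -powRN -powRD ?(gt_eqF l0) ?implybT//.
by congr (_ `^ _); field.
Qed.

End conclusion.

(** * Boundary charts *)

Section charts.
Context {R : realType} {n : nat}.

Definition height (T : 'rV[R]_n.+1 -> 'rV[R]_n.+1) (phi : 'rV[R]_n -> R)
  (x : 'rV[R]_n.+1) : R := row_last (T x) - phi (row_init (T x)).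

(** With an arbitrary isometry T, rotated and reflected graphs are included; with
    an arbitrary region B, an epigraph is a single chart with B = setT. *)
Record graph_chart (D B : set 'rV[R]_n.+1) (T : 'rV[R]_n.+1 -> 'rV[R]_n.+1)
    (phi : 'rV[R]_n -> R) (Lam kap : R) : Prop := GraphChart {
  chart_add : forall x y, T (x + y) = T x + T y;
  chart_isometry : forall x, enorm (T x) = enorm x;
  chart_surj : forall y, exists x, T x = y;
  chart_lipschitz : elipschitz Lam phi;
  chart_Lam_ge0 : 0 <= Lam;
  chart_kap_ge1 : 1 <= kap;
  chart_above : forall y, B y -> 0 < height T phi y -> D y;
  chart_dist : forall y, B y -> D y ->
    dist_compl D y <= kap * height T phi y /\
    height T phi y <= kap * dist_compl D y }.

Section chart_theory.
Variables (D B : set 'rV[R]_n.+1) (T : 'rV[R]_n.+1 -> 'rV[R]_n.+1)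
  (phi : 'rV[R]_n -> R) (Lam kap : R).
Hypotheses (oD : open D) (Dc0 : ~` D !=set0)
  (hB : graph_chart D B T phi Lam kap).
Let delta := dist_compl D.
Let h := height T phi.
Let mu := lebesgue_row n.+1 : {sigma_finite_measure set 'rV[R]_n.+1 -> \bar R}.

Let TB x y : T (x - y) = T x - T y.
Proof. exact: (isometryB (chart_add hB)). Qed.

Let cphi : continuous phi.
Proof. exact: elipschitz_continuous (chart_lipschitz hB). Qed.

Let kap0 : 0 < kap.
Proof. exact: lt_le_trans ltr01 (chart_kap_ge1 hB). Qed.

Let measurable_preslab a w b c : measurable (T @^-1` slab phi a w b c).
Proof.
rewrite -[X in measurable X]setTI.
apply: (measurable_isometry (chart_add hB) (chart_isometry hB)) => //.
exact: measurable_slab.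
Qed.

Let lebesgue_preslab a w b c : 0 <= w -> b <= c ->
  mu (T @^-1` slab phi a w b c) = ((c - b) * w ^+ n)%:E.
Proof.
move=> w0 bc; rewrite /mu.
rewrite (lebesgue_row_isometry (chart_add hB) (chart_isometry hB) (chart_surj hB)).
  exact: lebesgue_row_slab.
exact: measurable_slab.
Qed.

Lemma height_gt0 x : B x -> D x -> 0 < h x.
Proof.
move=> Bx Dx; have [+ _] := chart_dist hB Bx Dx.
by have := dist_compl_gt0 oD Dc0 Dx => d0 /(lt_le_trans d0); rewrite pmulr_rgt0.
Qed.

(** In the coordinates T the layer lies in the slab of height kap * t over a cube
    of side 2 * a. *)
Lemma chart_layer_le X y a t : measurable X -> 0 <= a -> 0 <= t ->
  (forall x, X x -> [/\ D x, B x, enorm (x - y) <= a & delta x <= t]) ->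
  (mu X <= (kap * t * (2 * a) ^+ n)%:E)%E.
Proof.
move=> mX a0 t0 hX.
have kt0 : 0 <= kap * t by rewrite mulr_ge0// ltW.
have a20 : 0 <= 2 * a by rewrite mulr_ge0.
have -> : kap * t = kap * t - 0 by rewrite subr0.
rewrite -(lebesgue_preslab (row_init (T y) - const_mx a) a20 kt0).
apply: le_measure; rewrite ?inE; [exact: mX|exact: measurable_preslab|].
move=> x /hX[Dx Bx xy dx]; split.
  move=> i; rewrite !mxE.
  have := coord_le_enorm (row_init (T x - T y)) i.
  move/le_trans => /(_ _ (enorm_row_init _)); rewrite -TB (chart_isometry hB).
  move/le_trans => /(_ _ xy); rewrite TB !mxE ler_norml => /andP[? ?].
  by apply/andP; split; lra.
have := height_gt0 Bx Dx; have [_ hk] := chart_dist hB Bx Dx.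
rewrite /h /height => hx0; rewrite (ltW hx0) /=.
by rewrite (le_trans hk)// ler_wpM2l// ltW.
Qed.

(** The first summand bounds |x - y| for y in the slab of x, the second compares
    delta y with lam * delta x there. *)
Definition chart_const : R := kap * (n%:R + 3 + Lam * n%:R) + 2 * kap ^+ 2.

Let chart_const_gt0 : 0 < chart_const.
Proof.
apply: ltr_wpDl; last by rewrite mulr_gt0// exprn_gt0.
apply: mulr_ge0; first exact: ltW.
apply: addr_ge0; first by rewrite addr_ge0.
by rewrite mulr_ge0// (chart_Lam_ge0 hB).
Qed.

Lemma slab_close lam x y : 0 < lam -> 0 < h x ->
  slab phi (row_init (T x)) (Num.max 1 lam * h x) (lam * h x)
    (2 * (lam * h x)) (T y) ->
  enorm (x - y) <= (n%:R + 3 + Lam * n%:R) * (Num.max 1 lam * h x).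
Proof.
move=> lam0 hx0 [cub]; set a := Num.max 1 lam * h x; rewrite -/(height T phi y) -/h.
have M1 : 1 <= Num.max 1 lam by rewrite le_max lexx.
have Ml : lam <= Num.max 1 lam by rewrite le_max lexx orbT.
have a1 : h x <= a by rewrite -[leLHS]mul1r ler_wpM2r// ltW.
have a2 : lam * h x <= a by rewrite ler_wpM2r// ltW.
have init_le : enorm (row_init (T x) - row_init (T y)) <= n%:R * a.
  rewrite (le_trans (enorm_le_sum _))//.
  have : forall i : 'I_n, `|(row_init (T x) - row_init (T y)) ord0 i| <= a.
    move=> i; have /andP[? ?] := cub i; rewrite mxE [_ (- _) _ _]mxE distrC.
    by rewrite ger0_norm ?subr_ge0// lerBlDl.
  move=> hi; rewrite (le_trans (ler_sum _ (fun i _ => hi i)))//.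
  by rewrite sumr_const card_ord mulr_natl.
move=> /andP[hy1 hy2]; rewrite -(chart_isometry hB) TB.
rewrite (le_trans (enorm_le_split _))//.
rewrite row_initD row_lastD row_initN row_lastN.
have philip := chart_lipschitz hB (row_init (T x)) (row_init (T y)).
have : `|row_last (T x) - row_last (T y)| <= 3 * a + Lam * (n%:R * a).
  rewrite (_ : row_last (T x) - _ = (h x - h y) +
      (phi (row_init (T x)) - phi (row_init (T y)))); last first.
    by rewrite /h /height; ring.
  rewrite (le_trans (ler_normD _ _))//; apply: lerD.
    by rewrite ler_norml; apply/andP; split; lra.
  by rewrite (le_trans philip)// ler_wpM2l// (chart_Lam_ge0 hB).
by move: (n%:R : R) init_le => N init_le; lra.
Qed.

(** The volume is that of the slab over a cube of side max 1 lam * h x, at heights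
    between lam * h x and 2 lam * h x. *)
Lemma chart_slab_ge lam x : 0 < lam -> D x ->
  (forall y, enorm (x - y) <= chart_const * Num.max 1 lam * delta x -> B y) ->
  ((lam * Num.max 1 lam ^+ n / kap ^+ n.+1 * delta x ^+ n.+1)%:E <=
   mu [set y | scaled_pairs D lam chart_const (chart_const * Num.max 1 lam)%R (x, y)])%E.
Proof.
move=> lam0 Dx xB; have dx := dist_compl_gt0 oD Dc0 Dx.
have M0 : 0 < Num.max 1 lam by rewrite lt_max ltr01.
have Bx : B x.
  apply: xB; rewrite subrr enorm0 mulr_ge0 ?(ltW dx)// mulr_ge0 ?(ltW M0)//.
  exact: ltW.
have hx0 := height_gt0 Bx Dx; have [dh hd] := chart_dist hB Bx Dx.
rewrite -/delta -/h in dh hd.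
set M := Num.max 1 lam in M0 xB *.
have Lam0 := chart_Lam_ge0 hB.
have kap1 := chart_kap_ge1 hB.
pose S := T @^-1` slab phi (row_init (T x)) (M * h x) (lam * h x) (2 * (lam * h x)).
apply: (@le_trans _ _ (mu S)).
  rewrite lebesgue_preslab ?mulr_ge0 ?(ltW M0) ?(ltW hx0)//; last first.
    by rewrite ler_peMl ?mulr_ge0 ?(ltW lam0) ?(ltW hx0)// ler1n.
  rewrite lee_fin (_ : 2 * _ - _ = lam * h x); last by ring.
  rewrite (_ : lam * h x * _ = lam * M ^+ n * h x ^+ n.+1); last first.
    by rewrite exprMn exprS; ring.
  rewrite -!mulrA ler_wpM2l ?(ltW lam0)// ler_wpM2l ?exprn_ge0 ?(ltW M0)//.
  rewrite mulrC -expr_div_n lerXn2r ?nnegrE ?divr_ge0 ?(ltW dx) ?(ltW kap0) ?(ltW hx0)//.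
  by rewrite ler_pdivrMr// mulrC.
apply: le_measure; rewrite ?inE; first exact: measurable_preslab.
  have := @measurable_xsection _ _ _ _ _ x
    (measurable_scaled_pairs oD Dc0 lam chart_const (chart_const * M)).
  by rewrite xsectionE.
move=> y Sy; have [_ /andP[]] := Sy; rewrite -/(height T phi y) -/h => hy1 hy2.
have xy1 := slab_close lam0 hx0 Sy.
set c := n%:R + 3 + Lam * n%:R in xy1.
have c0 : 0 <= c by rewrite /c !addr_ge0// mulr_ge0.
have xy : enorm (x - y) <= chart_const * M * delta x.
  rewrite (le_trans xy1)// -/M (@le_trans _ _ (c * (M * (kap * delta x))))//.
    by rewrite ler_wpM2l// ler_wpM2l// ltW.
  rewrite (_ : c * _ = kap * c * M * delta x); last by ring.
  rewrite ler_wpM2r ?(ltW dx)// ler_wpM2r ?(ltW M0)// /chart_const -/c lerDl.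
  by rewrite mulr_ge0// exprn_ge0// ltW.
have By := xB _ xy.
have lhx0 : 0 < lam * h x by rewrite mulr_gt0.
have hy0 : 0 < h y := lt_le_trans lhx0 hy1.
have Dy := chart_above hB By hy0.
have [dhy hdy] := chart_dist hB By Dy; rewrite -/delta -/h in dhy hdy.
have dy := dist_compl_gt0 oD Dc0 Dy; rewrite -/delta in dy.
have k2 : 2 * kap ^+ 2 <= chart_const by rewrite lerDr mulr_ge0// ltW.
split => //=; rewrite -/delta.
- apply: (@le_trans _ _ (2 * kap ^+ 2 * delta y)); last by rewrite ler_wpM2r// ltW.
  apply: (@le_trans _ _ (kap * (lam * h x))).
    by rewrite mulrCA ler_wpM2l// ltW.
  apply: (@le_trans _ _ (kap * (kap * delta y))).
    by rewrite ler_wpM2l ?(ltW kap0)// (le_trans hy1).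
  by rewrite mulrA -expr2 -mulrA ler_peMl ?ler1n// mulr_ge0 ?exprn_ge0 ?(ltW kap0)// ltW.
- apply: (@le_trans _ _ (2 * kap ^+ 2 * lam * delta x)); last first.
    by rewrite ler_wpM2r ?(ltW dx)// ler_wpM2r// ltW.
  apply: (le_trans dhy); apply: (@le_trans _ _ (kap * (2 * (lam * (kap * delta x))))).
    rewrite ler_wpM2l ?(ltW kap0)// (le_trans hy2)// ler_wpM2l// ler_wpM2l// ltW//.
  by rewrite expr2 le_eqVlt; apply/orP; left; apply/eqP; ring.
Qed.

Section chart_absorption.
Variables (A : R -> R) (s : R).
Hypotheses (hN : N_function A) (hD : Delta2 A) (s01 : 0 < s < 1).

(** Near the boundary: the slab has volume of order
    lam (max 1 lam)^n (delta x)^(n+1), while the points x sent to a given y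
    lie in a layer of thickness of order delta y / lam. *)
Lemma absorbed_chart I (G : R -> set 'rV[R]_n.+1) :
  (forall lam, 0 < lam -> I lam -> [/\ measurable (G lam), G lam `<=` D &
    forall x y, G lam x ->
      enorm (x - y) <= chart_const * Num.max 1 lam * delta x -> B y]) ->
  absorbed D A s 1 I G.
Proof.
move=> hG; set K := chart_const.
have K0 : 0 < K by exact: chart_const_gt0.
pose Bd := kap ^+ n.+1 * (kap * K * (2 * K * K) ^+ n).
have Bd0 : 0 <= Bd.
  by rewrite !mulr_ge0 ?exprn_ge0 ?mulr_ge0 ?(ltW kap0) ?(ltW K0).
have [C0 C00 hC] := hardy_transfer oD Dc0 hN hD s01 K0 Bd0.
exists C0 => // lam eps lam0 Ilam eps0 hlam.
have [mG GD GB] := hG lam lam0 Ilam.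
have M0 : 0 < Num.max 1 lam by rewrite lt_max ltr01.
apply: (hC lam (K * Num.max 1 lam) (lam * Num.max 1 lam ^+ n / kap ^+ n.+1) eps 1%N) => //.
- exact: mulr_gt0.
- by rewrite divr_gt0 ?exprn_gt0// mulr_gt0// exprn_gt0.
- by move=> x Gx; apply: chart_slab_ge => //; [exact: GD|move=> y; exact: GB].
set M := Num.max 1 lam in M0 GB *.
move=> y Dy; have dy := dist_compl_gt0 oD Dc0 Dy; rewrite -/delta in dy *.
pose t := K * delta y / lam.
have t0 : 0 <= t by rewrite divr_ge0 ?mulr_ge0 ?(ltW K0) ?(ltW dy) ?(ltW lam0).
apply: (@le_trans _ _ (kap * t * (2 * (K * M * t)) ^+ n)%:E).
  apply: (@chart_layer_le _ y) => //.
  - exact: measurable_scaled_preimage.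
  - by apply: mulr_ge0 => //; apply: mulr_ge0; exact: ltW.
  move=> x [Gx [/= Dx _ xy xy1 xy2]].
  have dxt : delta x <= t by rewrite ler_pdivlMr// mulrC.
  split => //.
  - apply: (GB x) => //; rewrite subrr enorm0 !mulr_ge0 ?(ltW K0) ?(ltW M0)//.
    exact: dist_compl_ge0.
  - by rewrite (le_trans xy)// ler_wpM2l// mulr_ge0// ltW.
rewrite lee_fin le_eqVlt; apply/orP; left; apply/eqP.
have l0 : lam != 0 by rewrite gt_eqF.
have k0 : kap ^+ n.+1 != 0 by rewrite expf_neq0// gt_eqF.
rewrite /t /Bd (_ : 2 * _ = (2 * K * K) * M * delta y / lam); last by field.
rewrite exprS in k0; rewrite addn1 !exprS expr_div_n !exprMn.
have ln : lam ^+ n != 0 by rewrite expf_neq0.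
move: (lam ^+ n) (kap ^+ n) (M ^+ n) (2 ^+ n) (K ^+ n) (delta y ^+ n) ln k0.
move=> u v p q r d u0; rewrite mulf_eq0 negb_or => /andP[k0 v0].
by field; rewrite u0 v0 l0 k0.
Qed.

(** For lam >= 1 the slab may be replaced by any ball reached from x. *)
Lemma absorbed_chart_ball K I (G : R -> set 'rV[R]_n.+1) : 0 < K ->
  (forall lam, 0 < lam -> I lam ->
    [/\ 1 <= lam, measurable (G lam), G lam `<=` D `&` B &
        corkscrew D K lam (G lam)]) ->
  absorbed D A s 1 I G.
Proof.
move=> K0 hG; have KK0 : 0 < 2 * K by rewrite mulr_gt0.
set c := 2 * K * n.+2%:R; have c0 : 0 < c by rewrite mulr_gt0.
pose Bd := c ^+ n.+1 * (kap * (2 * K) * (2 * (2 * K * (2 * K))) ^+ n).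
have Bd0 : 0 <= Bd.
  by rewrite !mulr_ge0 ?exprn_ge0 ?mulr_ge0 ?(ltW kap0) ?(ltW c0) ?(ltW K0).
have [C0 C00 hC] := hardy_transfer oD Dc0 hN hD s01 KK0 Bd0.
exists C0 => // lam eps lam0 Ilam eps0 hlam.
have [lam1 mG GDB ck] := hG lam lam0 Ilam.
have M0 : 0 < Num.max 1 lam by rewrite lt_max ltr01.
apply: (hC lam (2 * K * Num.max 1 lam) ((lam / c) ^+ n.+1) eps 1%N) => //.
- exact: mulr_gt0.
- by rewrite exprn_gt0// divr_gt0.
- by move=> x /GDB[].
- move=> x Gx; have [y0 [h1 h2 h3]] := ck x Gx.
  by apply: (scaled_pairs_ball _ _ _ _ _ h1) => //; have [] := GDB _ Gx.
move=> y Dy; have dy := dist_compl_gt0 oD Dc0 Dy; rewrite -/delta in dy *.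
pose t := 2 * K * delta y / lam.
have t0 : 0 <= t by apply: divr_ge0; [apply: mulr_ge0|]; exact: ltW.
have ltE : lam * t = 2 * K * delta y by rewrite mulrC divfK// gt_eqF.
apply: (@le_trans _ _ (kap * t * (2 * (2 * K * (2 * K) * delta y)) ^+ n)%:E).
  apply: (@chart_layer_le _ y) => //.
  - exact: measurable_scaled_preimage.
  - by apply: mulr_ge0; [apply: mulr_ge0|]; exact: ltW.
  move=> x [Gx [/= Dx _ xy xy1 xy2]].
  have dxt : delta x <= t by rewrite ler_pdivlMr// mulrC.
  have [_ Bx] := GDB _ Gx; split => //.
  rewrite (le_trans xy)// max_r// -!mulrA ler_wpM2l// ler_wpM2l ?(ltW K0)//.
  by rewrite [leRHS]mulrA.
rewrite lee_fin le_eqVlt; apply/orP; left; apply/eqP.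
have l0 : lam != 0 by rewrite gt_eqF.
have cn : c ^+ n.+1 != 0 by rewrite expf_neq0// gt_eqF.
rewrite /t /Bd [2 * (_ * delta y)]mulrA exprMn addn1.
rewrite expr_div_n [lam ^+ n.+2]exprS [delta y ^+ _]exprS.
have ln : lam ^+ n.+1 != 0 by rewrite expf_neq0.
move: (lam ^+ n.+1) (c ^+ n.+1) ((2 * (2 * K * (2 * K))) ^+ n) (delta y ^+ n) ln cn.
by move=> u v q d u0 v0; field; rewrite u0 v0 l0.
Qed.

End chart_absorption.
End chart_theory.
End charts.

(** * Epigraphs and complements of Lipschitz domains *)

Section heights.
Context {R : realType} {n : nat}.

Lemma elipschitz_abs L (phi : 'rV[R]_n -> R) :
  elipschitz L phi -> elipschitz `|L| phi.
Proof.
by move=> hL x y; rewrite (le_trans (hL x y))// ler_wpM2r ?enorm_ge0// ler_norm.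
Qed.

Lemma height_le Lam (T : 'rV[R]_n.+1 -> 'rV[R]_n.+1) (phi : 'rV[R]_n -> R) :
  (forall x y, T (x + y) = T x + T y) -> (forall x, enorm (T x) = enorm x) ->
  elipschitz Lam phi -> 0 <= Lam -> forall x y,
  height T phi x - height T phi y <= (1 + Lam) * enorm (x - y).
Proof.
move=> TD Tiso hphi Lam0 x y.
have -> : height T phi x - height T phi y = row_last (T (x - y)) +
    (phi (row_init (T y)) - phi (row_init (T x))).
  by rewrite (isometryB TD) row_lastD row_lastN /height; ring.
rewrite mulrDl mul1r; apply: lerD.
  by rewrite -Tiso (le_trans (ler_norm _))// row_last_le_enorm.
rewrite (le_trans (ler_norm _))// (le_trans (hphi _ _))// ler_wpM2l//.
rewrite enormBC -[leRHS]Tiso (isometryB TD).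
by have := enorm_row_init (T x - T y); rewrite row_initD row_initN.
Qed.

Lemma enorm_vertical (t : R) : enorm (row_rcons (0 : 'rV[R]_n, t)) = `|t|.
Proof.
apply/eqP; rewrite -(@eqrXn2 _ 2) ?enorm_ge0//.
by rewrite enorm_split row_init_rcons row_last_rcons enorm0 expr0n addr0 real_normK ?num_real.
Qed.

Section epigraph.
Variables (Phi : 'rV[R]_n -> R) (L : R).
Hypothesis hPhi : elipschitz L Phi.

Lemma epigraph_compl_neq0 : ~` epigraph Phi !=set0.
Proof.
by exists (row_rcons (0, Phi 0)); rewrite /epigraph/= row_init_rcons row_last_rcons ltxx.
Qed.

(** The vertical foot point on the graph bounds the distance from above, the
    Lipschitz continuity of the height bounds it from below. *)
Lemma epigraph_chart :
  graph_chart (epigraph Phi) setT id Phi `|L| (1 + `|L|).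
Proof.
have hL := elipschitz_abs hPhi.
have hle := @height_le `|L| id Phi (fun=> fun=> erefl) (fun=> erefl) hL (normr_ge0 _).
split => //.
- by move=> y; exists y.
- by rewrite lerDl.
- by move=> y _; rewrite /height subr_gt0.
move=> y _ Dy; have hy : 0 < height id Phi y by rewrite /height subr_gt0.
have c0 : 0 < 1 + `|L| by rewrite ltr_pwDl.
split.
  apply: (@le_trans _ _ (height id Phi y)); last first.
    by rewrite ler_peMl ?lerDl// ltW.
  pose z := row_rcons (row_init y, Phi (row_init y)).
  have yz : y - z = row_rcons (0, height id Phi y).
    apply: row_split_inj; rewrite ?(row_initD, row_lastD, row_initN, row_lastN).
      by rewrite !row_init_rcons subrr.
    by rewrite !row_last_rcons.
  rewrite -[leRHS]gtr0_norm// -enorm_vertical -yz.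
  have Dz : ~ epigraph Phi z.
    by rewrite /epigraph/= row_init_rcons row_last_rcons ltxx.
  exact: (dist_compl_le y Dz).
rewrite mulrC -ler_pdivrMr//; apply: (dist_compl_ge epigraph_compl_neq0) => w Dw.
rewrite ler_pdivrMr// mulrC (le_trans _ (hle y w))//.
by rewrite lerDl oppr_ge0 /height subr_le0 leNgt; apply/negP.
Qed.

End epigraph.

Section local_chart.
Variables (D U : set 'rV[R]_n.+1) (r0 Lip : R) (z : 'rV[R]_n.+1)
  (L : {linear 'rV[R]_n.+1 -> 'rV[R]_n.+1}) (phi : 'rV[R]_n -> R).
Hypotheses (DU : ~` D = closure U) (r00 : 0 < r0) (Uz : closure U z)
  (Liso : forall x, enorm (L x) = enorm x) (hphi : elipschitz Lip phi)
  (hL : L @` U `&` eball (L z) r0 = epigraph phi `&` eball (L z) r0).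

Let T x := flip_last (L x).
Let psi u := - phi u.
Let h := height T psi.
Let Lam := `|Lip|.

Let hE x : h x = phi (row_init (L x)) - row_last (L x).
Proof. by rewrite /h /height /T /psi row_init_flip row_last_flip opprK addrC. Qed.

Let TD x y : T (x + y) = T x + T y.
Proof. by rewrite /T linearD flip_lastD. Qed.

Let Tiso x : enorm (T x) = enorm x.
Proof. by rewrite /T enorm_flip_last Liso. Qed.

Let psi_lip : elipschitz Lam psi.
Proof.
by move=> x y; rewrite /psi -opprD normrN; exact: elipschitz_abs.
Qed.

Let Lam0 : 0 <= Lam. Proof. exact: normr_ge0. Qed.

Let h_le x y : h x - h y <= (1 + Lam) * enorm (x - y).
Proof. exact: height_le. Qed.

Let U_below y : enorm (y - z) < r0 -> U y <-> h y < 0.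
Proof.
move=> yz; have Lyz : eball (L z) r0 (L y) by rewrite /eball/= -linearB Liso.
rewrite hE subr_lt0; split=> [Uy|hy].
  have : (L @` U `&` eball (L z) r0) (L y) by split => //; exists y.
  by rewrite hL => -[].
have : (epigraph phi `&` eball (L z) r0) (L y) by [].
rewrite -hL => -[[u Uu Luy] _]; suff -> : y = u by [].
by apply/eqP; rewrite -subr_eq0; apply/eqP/enorm_eq0; rewrite -Liso linearB Luy subrr enorm0.
Qed.

Let vertical : exists v, enorm v = 1 /\ forall t y, h (y + t *: v) = h y - t.
Proof.
have [v Lv] := linear_isometry_surj Liso (row_rcons (0, 1)).
exists v; split; first by rewrite -Liso Lv enorm_vertical normr1.
move=> t y; rewrite !hE linearD linearZ/= Lv row_initD row_lastD.
have -> : t *: row_rcons (0 : 'rV[R]_n, 1 : R) = row_rcons (0, t).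
  by apply/rowP => i; rewrite !mxE; case: unliftP => [j|] _ /=; rewrite ?mxE ?mulr0 ?mulr1.
by rewrite row_init_rcons row_last_rcons /= addr0 opprD addrA.
Qed.

(* A point of height 0 or less is a limit of points slightly below it, which
   belong to U; a point of positive height has a neighbourhood of points of positive
   height, which avoids U. *)
Let D_above y : enorm (y - z) < r0 -> D y <-> 0 < h y.
Proof.
move=> yz; have -> : D y <-> ~ closure U y.
  by rewrite -DU; split=> [Dy|/contrapT].
split=> [ncl|hy cl].
  rewrite ltNge; apply/negP => hy; apply: ncl => V /nbhs_eballP[r r1 rV].
  have [v [v1 hv]] := vertical.
  pose t := Num.min r (r0 - enorm (y - z)) / 2.
  have t0 : 0 < t by rewrite divr_gt0// lt_min r1 subr_gt0.
  have tr : t < r.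
    by rewrite ltr_pdivrMr// gt_min; apply/orP; left; rewrite ltr_pMr// ltr1n.
  have tz : t < r0 - enorm (y - z).
    rewrite ltr_pdivrMr// gt_min; apply/orP; right; rewrite ltr_pMr ?ltr1n//.
    by rewrite subr_gt0.
  exists (y + t *: v); split; last first.
    by apply: rV; rewrite /eball/= addrAC subrr add0r enormZ v1 mulr1 gtr0_norm.
  apply/U_below.
    rewrite addrAC (le_lt_trans (ler_enormD _ _))// enormZ v1 mulr1 gtr0_norm//.
    by rewrite -ltrBrDl.
  by rewrite hv subr_lt0 (le_lt_trans hy).
have c0 : 0 < 1 + Lam by rewrite ltr_pwDl.
pose r := Num.min (r0 - enorm (y - z)) (h y / (1 + Lam)).
have r1 : 0 < r by rewrite lt_min subr_gt0 yz divr_gt0.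
have [u [Uu]] := cl _ (nbhs_eball y r1).
rewrite /eball/= lt_min => /andP[uy1 uy2].
have /U_below : enorm (u - z) < r0.
  by rewrite (le_lt_trans (ler_enormB _ y _))// -ltrBrDr.
move=> /iffLR/(_ Uu); apply/negP; rewrite -leNgt.
have := h_le y u; rewrite enormBC.
by move: uy2; rewrite ltr_pdivlMr// mulrC => u1 u2; lra.
Qed.

(** Here U lies above the graph of phi, hence D below it, and the last coordinate
    is reflected to bring D above.  At half the radius, the foot point of a point
    of small height stays in the region described by the chart, and so do all
    points of the complement that are closer than z. *)
Lemma local_chart : graph_chart D (eball z (r0 / 2)) T psi Lam (1 + Lam).
Proof.
have half : r0 / 2 < r0 by rewrite ltr_pdivrMr// ltr_pMr// ltr1n.
have Dz : ~ D z by change ((~` D) z); rewrite DU.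
have Dc0 : ~` D !=set0 by exists z.
have zz : enorm (z - z) < r0 by rewrite subrr enorm0.
have c1 : 1 <= 1 + Lam by rewrite lerDl.
have c0 : 0 < 1 + Lam by rewrite ltr_pwDl.
split => //.
- move=> y; have [x Lx] := linear_isometry_surj Liso (flip_last y).
  by exists x; rewrite /T Lx flip_lastK.
- by move=> y yz hy; apply/D_above => //; exact: lt_trans yz half.
move=> y; rewrite /eball/= => yz Dy; have yz' := lt_trans yz half.
have hy : 0 < h y by apply/D_above.
have hz : h z <= 0 by rewrite leNgt; apply/negP => /(D_above zz).
split.
  apply: (@le_trans _ _ (h y)); last by rewrite ler_peMl// ltW.
  have [yr|yr] := ltP (h y) (r0 / 2); last first.
    by rewrite (le_trans (dist_compl_le y Dz))// (le_trans (ltW yz)).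
  have [v [v1 hv]] := vertical.
  have Dfoot : ~ D (y + h y *: v).
    suff fz : enorm (y + h y *: v - z) < r0.
      by move/(D_above fz); rewrite hv subrr ltxx.
    rewrite addrAC (le_lt_trans (ler_enormD _ _))// enormZ v1 mulr1 gtr0_norm//.
    by lra.
  rewrite (le_trans (dist_compl_le y Dfoot))// opprD addrA subrr add0r.
  by rewrite enormN enormZ v1 mulr1 gtr0_norm.
rewrite mulrC -ler_pdivrMr//; apply: dist_compl_ge => // w Dw.
rewrite ler_pdivrMr// [leRHS]mulrC -/h.
have [wz|wz] := ltP (enorm (w - z)) r0.
  have hw : h w <= 0 by rewrite leNgt; apply/negP => hw; apply: Dw; apply/D_above.
  by have := h_le y w; lra.
apply: (@le_trans _ _ ((1 + Lam) * enorm (y - z))).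
  by have := h_le y z; lra.
rewrite ler_wpM2l ?(ltW c0)//.
have := ler_enormB w y z; rewrite (enormBC w y) => wyz; lra.
Qed.

End local_chart.
End heights.

(** * The three regimes for a domain with compact complement *)

Section inward.
Context {R : realType} {n : nat}.
Variables (D : set 'rV[R]_n.+1) (A : R -> R) (s : R).
Hypotheses (oD : open D) (Dc0 : ~` D !=set0) (hN : N_function A)
  (hD : Delta2 A) (s01 : 0 < s < 1).

(** Contractions towards the boundary need no regularity of D, at the price of
    the full factor lam ^- n.+1. *)
Lemma absorbed_inward : absorbed D A s n.+1 [set lam | lam <= 1] (fun=> D).
Proof.
apply: (@absorbed_ball _ _ _ _ _ oD Dc0 hN hD s01 2 16) => // lam lam0 lam1.
split => //; first exact: open_measurable_row.
  move=> x Dx; have [|y0 [h1 h2 h3]] := dist_compl_inward oD Dc0 (t := lam) Dx.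
    by rewrite lam0.
  exists y0; rewrite max_l// mulr1; split => //.
  by lra.
(* 16 = 4 * 4: |x - y| <= 4 * delta x and lam * delta x <= 4 * delta y. *)
move=> y Dy; exists y => x Dx [/= _ _ xy xy1 _].
rewrite max_l// mulr1 in xy.
by rewrite ler_pdivlMr//; nra.
Qed.

End inward.

Section exterior.
Context {R : realType} {n : nat}.
Variables (D : set 'rV[R]_n.+1) (A : R -> R) (s Rad : R).
Hypotheses (oD : open D) (Dc0 : ~` D !=set0) (hN : N_function A)
  (hD : Delta2 A) (s01 : 0 < s < 1) (Rad0 : 0 <= Rad)
  (DRad : forall w, ~ D w -> enorm w <= Rad).
Let delta := dist_compl D.

Let unit_vector : exists e : 'rV[R]_n.+1, enorm e = 1.
Proof. by exists (row_rcons (0, 1)); rewrite enorm_vertical normr1. Qed.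

Let enorm_le_dist x : enorm x <= Rad + delta x.
Proof.
rewrite -lerBlDl; apply: (dist_compl_ge Dc0) => w Dw.
have := ler_enormB x w 0; rewrite !subr0 => h; have := DRad Dw; lra.
Qed.

(** Beyond a fixed distance r all directions are alike, and a single ray of
    reference points serves every x. *)
Lemma corkscrew_outward r lam (G : set 'rV[R]_n.+1) : 0 < r -> 1 <= lam ->
  (forall x, G x -> D x /\ r <= lam * delta x) ->
  corkscrew D (2 * Rad / r + 2) lam G.
Proof.
move=> r0 lam1 hG x /hG[Dx rd]; have [e e1] := unit_vector.
set d := lam * delta x in rd.
have dx := dist_compl_gt0 oD Dc0 Dx; rewrite -/delta in dx.
have d0 : 0 < d := lt_le_trans r0 rd.
have xd : delta x <= d by rewrite ler_peMl// ltW.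
have Rd : 2 * Rad <= 2 * Rad / r * d.
  by rewrite mulrAC ler_pdivlMr// ler_wpM2l// mulr_ge0.
pose y0 := (Rad + d) *: e.
have ny0 : enorm y0 = Rad + d.
  by rewrite enormZ e1 mulr1 ger0_norm// addr_ge0// ltW.
have dy1 : d <= delta y0.
  apply: (dist_compl_ge Dc0) => w Dw; have := ler_enormB y0 w 0.
  by rewrite !subr0 ny0 => h; have := DRad Dw; lra.
have dy2 : delta y0 <= 2 * Rad + d.
  have [w Dw] := Dc0; rewrite (le_trans (dist_compl_le y0 Dw))//.
  rewrite (le_trans (ler_enormD _ _))// enormN ny0.
  by have := DRad Dw; lra.
exists y0; rewrite max_r// -!mulrA -/d -/delta; split.
- rewrite (le_trans (ler_enormD _ _))// enormN ny0.
  have := enorm_le_dist x; rewrite mulrDl.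
  by rewrite mulrA; lra.
- rewrite (le_trans dy1)// ler_peMl ?(le_trans (ltW d0))//.
  have : 0 <= 2 * Rad / r by rewrite divr_ge0 ?mulr_ge0// ltW.
  by lra.
- by rewrite mulrDl mulrA; lra.
Qed.

Lemma measurable_dist_le r : measurable [set x | r <= delta x].
Proof. by apply: measurable_set_ler => //; exact: measurable_dist_compl. Qed.

Lemma absorbed_outward r : 0 < r ->
  absorbed D A s n.+1 [set lam | 1 <= lam] (fun=> D `&` [set x | r <= delta x]).
Proof.
move=> r0; set K := 2 * Rad / r + 2.
have K0 : 0 < K by rewrite ltr_wpDl// divr_ge0 ?mulr_ge0// ltW.
have c0 : 0 <= Rad / r + 1 by rewrite addr_ge0// divr_ge0// ltW.
have KK0 : 0 <= (Rad / r + 1) * (2 * K) by rewrite mulr_ge0// mulr_ge0// ltW.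
apply: (absorbed_ball oD Dc0 hN hD s01 K0 KK0) => lam lam0 /= lam1.
split.
- by apply: measurableI; [exact: open_measurable_row|exact: measurable_dist_le].
- by move=> x [].
- apply: corkscrew_outward => // x [Dx rx]; split => //.
  by rewrite (le_trans rx)// ler_peMl// dist_compl_ge0.
(* Far from the complement, |x| itself is at most a multiple of delta x. *)
move=> y Dy; exists 0 => x [Dx /= rx] [/= _ _ _ xy _].
rewrite subr0 (le_trans (enorm_le_dist x))//.
rewrite (@le_trans _ _ ((Rad / r + 1) * delta x))//.
  rewrite mulrDl mul1r lerD2r mulrAC ler_pdivlMr// ler_wpM2l//.
by rewrite -!mulrA ler_wpM2l// !mulrA ler_pdivlMr// mulrC.
Qed.

Section near_boundary.
Variables (r0 Lam kap : R) (zs : seq 'rV[R]_n.+1).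
Hypotheses (r00 : 0 < r0) (Lam0 : 0 <= Lam) (kap1 : 1 <= kap)
  (charts : forall z, z \in zs -> exists T phi,
     graph_chart D (eball z (r0 / 2)) T phi Lam kap)
  (cover : forall x, D x -> delta x < r0 / 8 ->
     exists2 z, z \in zs & enorm (x - z) < r0 / 4).

Let CK := chart_const (n := n) Lam kap.
Let CK0 : 0 <= CK.
Proof.
have kap0 : 0 <= kap := le_trans ler01 kap1.
by rewrite /CK /chart_const !addr_ge0 ?mulr_ge0 ?addr_ge0 ?mulr_ge0 ?exprn_ge0.
Qed.

(** Below this distance, a move of length chart_const * delta x from a point of
    eball z (r0 / 4) does not leave the chart region eball z (r0 / 2). *)
Definition near_radius : R := r0 / (8 * (CK + 1)).

Lemma near_radius_gt0 : 0 < near_radius.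
Proof. by rewrite divr_gt0// mulr_gt0// ltr_wpDl. Qed.

Let near_radiusE : near_radius * (8 * (CK + 1)) = r0.
Proof. by rewrite divfK// gt_eqF// mulr_gt0// ltr_wpDl. Qed.

Let near_radius_le : near_radius <= r0 / 8.
Proof.
have := mulr_ge0 CK0 (ltW near_radius_gt0); have := near_radiusE.
by rewrite ler_pdivlMr//; move: near_radius CK => r c ? ?; lra.
Qed.

Let radii_le : r0 / 8 + r0 / 4 < r0 / 2. Proof. by have := r00 => ?; lra. Qed.

(* The points whose slab stays in the chart at z, and those of the same chart
   which are sent to the reference ray. *)
Let G1 (z : 'rV[R]_n.+1) (lam : R) := D `&` eball z (r0 / 4) `&`
  [set x | Num.max 1 lam * delta x < near_radius].

Let G2 (z : 'rV[R]_n.+1) (lam : R) := D `&` eball z (r0 / 4) `&`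
  [set x | near_radius <= lam * delta x].

Let mdelta : measurable_fun setT delta.
Proof. exact: measurable_dist_compl. Qed.

Let mG1 z lam : measurable (G1 z lam).
Proof.
apply: measurableI; last by apply: measurable_set_ltr => //; exact: measurable_funM.
by apply: measurableI; [exact: open_measurable_row|exact: measurable_eball].
Qed.

Let mG2 z lam : measurable (G2 z lam).
Proof.
apply: measurableI; last by apply: measurable_set_ler => //; exact: measurable_funM.
by apply: measurableI; [exact: open_measurable_row|exact: measurable_eball].
Qed.

Let absorbed_G1 z I : z \in zs -> absorbed D A s 1 I (G1 z).
Proof.
move=> /charts[T [phi hz]]; apply: (absorbed_chart oD Dc0 hz hN hD s01) => lam lam0 _.
split; [exact: mG1|by move=> x [[]]|].
move=> x y [[Dx]]; rewrite /eball/= => xz xr; rewrite -/CK -/delta -mulrA => xy.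
rewrite (le_lt_trans (ler_enormB _ x _))// (enormBC y).
have {}xy := le_trans xy (ler_wpM2l CK0 (ltW xr)).
have rE := near_radiusE; have r1 := near_radius_gt0.
have cr : CK * near_radius < r0 / 8.
  by rewrite ltr_pdivlMr// -rE; move: near_radius CK r1 => r c r1; lra.
apply: (lt_trans _ radii_le).
by apply: ltrD; [exact: le_lt_trans xy cr|exact: xz].
Qed.

Let absorbed_G2 z : z \in zs -> absorbed D A s 1 [set lam | 1 <= lam] (G2 z).
Proof.
move=> /charts[T [phi hz]].
have K0 : 0 < 2 * Rad / near_radius + 2.
  by apply: ltr_wpDl => //; apply: divr_ge0; [exact: mulr_ge0|exact/ltW/near_radius_gt0].
apply: (absorbed_chart_ball oD Dc0 hz hN hD s01 K0) => lam lam0 /= lam1.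
split => //.
  move=> x [[Dx xz] _]; split => //; move: xz; rewrite /eball/= => xz.
  by have := r00 => ?; lra.
by apply: corkscrew_outward => //; [exact: near_radius_gt0|move=> x [[]]].
Qed.

Lemma near_measurable (G : 'rV[R]_n.+1 -> R -> set 'rV[R]_n.+1) lam :
  (forall z, measurable (G z lam)) ->
  measurable (\big[setU/set0]_(z <- zs) G z lam).
Proof. by move=> mG; apply: bigsetU_measurable. Qed.

Let near_sub (G : 'rV[R]_n.+1 -> R -> set 'rV[R]_n.+1) lam x z :
  z \in zs -> G z lam x -> (\big[setU/set0]_(z <- zs) G z lam) x.
Proof. by move=> zzs Gx; rewrite -bigcup_seq; exists z. Qed.

Lemma absorbed_near_inward : exists G, [/\
  absorbed D A s 1 [set lam | lam <= 1] G, forall lam, measurable (G lam) &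
  forall lam, lam <= 1 -> D `<=` G lam `|` (D `&` [set x | near_radius <= delta x])].
Proof.
exists (fun lam => \big[setU/set0]_(z <- zs) G1 z lam); split.
- by apply: absorbed_bigcup => // z; exact: absorbed_G1.
- by move=> lam; apply: near_measurable => z; exact: mG1.
move=> lam lam1 x Dx; have [rx|rx] := leP near_radius (delta x); first by right.
left; have [|z zzs xz] := cover Dx; first exact: lt_le_trans near_radius_le.
by apply: (near_sub zzs); split => //=; rewrite max_l// mul1r.
Qed.

Lemma absorbed_near_outward : exists G, [/\
  absorbed D A s 1 [set lam | 1 <= lam] G, forall lam, measurable (G lam) &
  forall lam, 1 <= lam -> D `<=` G lam `|` (D `&` [set x | near_radius <= delta x])].
Proof.
pose G12 z lam := G1 z lam `|` G2 z lam.
have mG12 z lam : measurable (G12 z lam) by apply: measurableU; [exact: mG1|exact: mG2].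
exists (fun lam => \big[setU/set0]_(z <- zs) G12 z lam); split.
- apply: absorbed_bigcup => //.
  move=> z zzs; apply: absorbed_setU => //; first exact: absorbed_G1.
  exact: absorbed_G2.
- by move=> lam; apply: near_measurable => z; exact: mG12.
move=> lam lam1 x Dx; have [rx|rx] := leP near_radius (delta x); first by right.
left; have [|z zzs xz] := cover Dx; first exact: lt_le_trans near_radius_le.
apply: (near_sub zzs); rewrite /G12.
have [rl|rl] := leP near_radius (lam * delta x); [right|left]; split => //=.
by rewrite max_r.
Qed.

End near_boundary.
End exterior.

(** * Covering the boundary *)

Section boundary.
Context {R : realType} {n : nat}.
Variables (D U : set 'rV[R]_n.+1).
Hypotheses (U0 : U !=set0) (bU : bounded_set U)
  (DU : ~` D = closure U).
Let delta := dist_compl D.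

Lemma bounded_compl : exists2 Rad, 0 <= Rad & forall w, ~ D w -> enorm w <= Rad.
Proof.
have [M [_ hM]] := bU.
exists (n.+1%:R * (`|M| + 1) + 1).
  by rewrite addr_ge0// mulr_ge0// addr_ge0.
move=> w; change ((~` D) w -> enorm w <= n.+1%:R * (`|M| + 1) + 1).
rewrite DU => cw; have [u [Uu]] := cw _ (nbhs_eball w ltr01).
rewrite /eball/= => uw.
have hu : `|u| <= `|M| + 1 by apply: hM => //; rewrite (le_lt_trans (ler_norm _))// ltrDl.
have := ler_enormB w u 0; rewrite !subr0 (enormBC w) => wu.
have : enorm u <= n.+1%:R * (`|M| + 1).
  by rewrite (le_trans (enorm_le_norm _))// ler_wpM2l.
by move: uw wu; lra.
Qed.

Let cU : compact (closure U).
Proof.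
apply: bounded_closed_compact; last exact: closed_closure.
have [Rad _ hRad] := bounded_compl.
exists Rad; split; first exact: num_real.
move=> M RM x Ux; rewrite /= (le_trans (norm_le_enorm _))// (le_trans _ (ltW RM))//.
by apply: hRad; change ((~` D) x); rewrite DU.
Qed.

(** A nearest point of closure U cannot be interior, since one could then move
    towards x inside U. *)
Lemma boundary_near x : D x -> exists2 z, (closure U `\` interior U) z &
  enorm (x - z) <= delta x.
Proof.
move=> Dx.
have Dc0 : ~` D !=set0.
  by rewrite DU; have [u Uu] := U0; exists u; exact: subset_closure.
have cU0 : closure U !=set0 by rewrite -DU.
have [z zU hz] := EVT_min_rV cU0 cU
  (continuous_subspaceT (elipschitz_continuous (elipschitz_enorm x))).
rewrite inE in zU; exists z; last first.
  apply: (dist_compl_ge Dc0) => w Dw; rewrite enormBC [leRHS]enormBC.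
  by apply: hz; rewrite inE -DU.
split=> // /nbhs_eballP[r r0 rU].
have xz0 : 0 < enorm (z - x).
  rewrite lt_def enorm_ge0 andbT; apply/eqP => /enorm_eq0/eqP; rewrite subr_eq0.
  by move=> /eqP zx; move: zU; rewrite -DU zx; apply.
pose t := r / (r + enorm (z - x)).
have rz : 0 < r + enorm (z - x) by rewrite addr_gt0.
have t0 : 0 < t by rewrite divr_gt0.
have t1 : t < 1 by rewrite ltr_pdivrMr// mul1r ltrDl.
have Uy : U (z + t *: (x - z)).
  apply: rU; rewrite /eball/= addrAC subrr add0r enormZ gtr0_norm// enormBC.
  by rewrite mulrAC ltr_pdivrMr// ltr_pM2l// ltrDr.
have := hz (z + t *: (x - z)); rewrite inE => /(_ (subset_closure Uy)).
have -> : z + t *: (x - z) - x = (1 - t) *: (z - x).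
  by apply/rowP => i; rewrite !mxE; ring.
rewrite enormZ ger0_norm ?subr_ge0 ?(ltW t1)// mulrBl mul1r lerBrDl.
by rewrite gerDr leNgt mulr_gt0.
Qed.

Lemma boundary_cover r : 0 < r -> exists2 zs : seq 'rV[R]_n.+1,
  (forall z, z \in zs -> (closure U `\` interior U) z) &
  forall x, D x -> delta x < r ->
    exists2 z, z \in zs & enorm (x - z) < 2 * r.
Proof.
move=> r0; set K := closure U `\` interior U.
have cK : compact K.
  apply: (@subclosed_compact _ K (closure U)) => //; last by move=> x [].
  by apply: closedI; [exact: closed_closure|apply: open_closedC; exact: open_interior].
move: cK; rewrite compact_cover => /(_ 'rV[R]_n.+1 K (fun z => eball z r)).
case=> [z _|z Kz|zs zsK hzs]; first exact: open_eball.
  by exists z => //; rewrite /eball/= subrr enorm0.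
exists (finmap.enum_fset zs) => [z zzs|x Dx dx].
  by have := zsK z zzs; rewrite inE.
have [w Kw xw] := boundary_near Dx.
have [z /= zzs wz] := hzs _ Kw; exists z => //.
rewrite (le_lt_trans (ler_enormB _ w _))// mulrDl mul1r ltrD//.
exact: le_lt_trans dx.
Qed.

End boundary.

(** * Choice of the scale *)

Section thresholds.
Context {R : realType}.

Lemma alpha_small_at0 (g : R -> \bar R) : limf_einf g 0^'+ = 0%E ->
  forall e, 0 < e -> exists2 l, 0 < l /\ l <= 1 & (g l < e%:E)%E.
Proof.
move=> hg e e0.
have [|l [l0 l1] gl] := @limf_einf_eq0_lt _ g _ [set l | 0 < l /\ l <= 1] e hg _ e0.
  near=> l; split; near: l; first exact: nbhs_right_gt.
  exact: nbhs_right_le.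
by exists l.
Unshelve. all: end_near. Qed.

Lemma alpha_small_aty (g : R -> \bar R) : limf_einf g +oo = 0%E ->
  forall e, 0 < e -> exists2 l, 0 < l /\ 1 <= l & (g l < e%:E)%E.
Proof.
move=> hg e e0.
have [|l l1 gl] := @limf_einf_eq0_lt _ g _ [set l | 1 <= l] e hg _ e0.
  exact: nbhs_pinfty_ge.
by exists l => //; split => //; exact: lt_le_trans l1.
Qed.

Lemma powR_ge1 (l s : R) : 0 < l -> 0 < s -> 1 <= l `^ s -> 1 <= l.
Proof.
move=> l0 s0; rewrite !leNgt; apply: contra => l1.
have s1 : 1 `^ s = 1 :> R by rewrite powR1.
by rewrite -s1; apply: gt0_ltr_powR => //; rewrite nnegrE ltW.
Qed.

Lemma powR_le1 (l s : R) : 0 < l -> 0 < s -> l `^ s <= 1 -> l <= 1.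
Proof.
move=> l0 s0; rewrite !leNgt; apply: contra => l1.
have s1 : 1 `^ s = 1 :> R by rewrite powR1.
by rewrite -s1; apply: gt0_ltr_powR => //; rewrite nnegrE ltW.
Qed.

End thresholds.

(* The dimension is N = n.+1. *)
Theorem theorem1p5 (R : realType) (n : nat) (D : set 'rV[R]_n.+1)
    (A : R -> R) (s : R) :
  open D -> N_function A -> Delta2 A -> 0 < s < 1 ->
  let alpha := orlicz_alpha s A in
  let weighted_alpha := fun l : R =>
    ((l `^ ((1 - n.+1%:R) / s))%:E * alpha l)%E in
  ((exists Phi : 'rV[R]_n -> R,
      (exists L : R, elipschitz L Phi) /\ D = epigraph Phi) ->
   limf_einf alpha 0^'+ = 0%E \/ limf_einf alpha +oo = 0%E ->
   FOHI s A D) /\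
  ((exists U : set 'rV[R]_n.+1, lipschitz_domain U /\ ~` D = closure U) ->
   [\/ limf_einf weighted_alpha +oo = 0%E /\ limf_einf alpha 0^'+ = 0%E,
       limf_einf weighted_alpha 0^'+ = 0%E |
       limf_einf alpha +oo = 0%E] ->
   FOHI s A D).
Proof.
move=> oD hN hD s01 alpha walpha.
have s0 : 0 < s by case/andP: s01.
split.
  move=> [Phi [[L hPhi] DE]] hal; rewrite DE in oD *.
  have Dc0 : ~` epigraph Phi !=set0 by exact: epigraph_compl_neq0.
  have hG : absorbed (epigraph Phi) A s 1 setT (fun=> epigraph Phi).
    apply: (absorbed_chart oD Dc0 (epigraph_chart hPhi) hN hD s01) => lam lam0 _.
    by split => //; exact: open_measurable_row.
  have small : forall eps, 0 < eps -> exists lam, [/\ 0 < lam, setT lam &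
      forall t, 0 <= t -> A (lam `^ s * t) <= eps * lam ^+ 1 * A t].
    move=> eps eps0.
    have [|lam [lam0 _ hlam]] := alpha_scale1 hN hD s01 (W := setT) _ eps0.
      move=> e e0; case: hal => [/alpha_small_at0|/alpha_small_aty] /(_ e e0).
        by case=> l [l0 _] al; exists l.
      by case=> l [l0 _] al; exists l.
    by exists lam.
  apply: (FOHI_of_cover oD Dc0 hN hD s01 hG hG small small).
  - by move=> lam _; exact: open_measurable_row.
  - by move=> lam _; exact: open_measurable_row.
  - by move=> *; left.
move=> [U [[[U0 _ _] bU [r0 [Lip [r00 hU]]]] DU]] hal.
have Dc0 : ~` D !=set0.
  by rewrite DU; have [u Uu] := U0; exists u; exact: subset_closure.
have [Rad Rad0 hRad] := bounded_compl bU DU.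
have r80 : 0 < r0 / 8 by rewrite divr_gt0.
have [zs zsK hzs] := boundary_cover U0 bU DU r80.
have charts z : z \in zs -> exists T phi,
    graph_chart D (eball z (r0 / 2)) T phi `|Lip| (1 + `|Lip|).
  move=> /zsK zK; have [L [phi [Liso hphi hL]]] := hU z zK.
  exists (fun x => flip_last (L x)), (fun u => - phi u).
  by apply: (local_chart DU r00 _ Liso hphi hL); case: zK.
have cover x : D x -> dist_compl D x < r0 / 8 ->
    exists2 z, z \in zs & enorm (x - z) < r0 / 4.
  move=> Dx dx; have [z zzs xz] := hzs x Dx dx; exists z => //.
  by rewrite (_ : r0 / 4 = 2 * (r0 / 8))//; field.
have Lip0 : 0 <= `|Lip| by [].
have kap1 : 1 <= 1 + `|Lip| by rewrite lerDl.
pose r := near_radius (n := n) r0 `|Lip| (1 + `|Lip|).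
have rr0 : 0 < r by exact: near_radius_gt0.
have far := absorbed_outward oD Dc0 hN hD s01 Rad0 hRad rr0.
have mfar := measurableI _ _ (open_measurable_row oD) (measurable_dist_le Dc0 r).
have to_ge1 lam k eps :
    [/\ 0 < lam, [set l | 1 <= l] (lam `^ s) &
      forall t, 0 <= t -> A (lam `^ s * t) <= eps * lam ^+ k * A t] ->
    exists lam, [/\ 0 < lam, [set l | 1 <= l] lam &
      forall t, 0 <= t -> A (lam `^ s * t) <= eps * lam ^+ k * A t].
  by move=> [l0 l1 hl]; exists lam; split => //; exact: powR_ge1 l1.
have to_le1 lam k eps :
    [/\ 0 < lam, [set l | l <= 1] (lam `^ s) &
      forall t, 0 <= t -> A (lam `^ s * t) <= eps * lam ^+ k * A t] ->
    exists lam, [/\ 0 < lam, [set l | l <= 1] lam &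
      forall t, 0 <= t -> A (lam `^ s * t) <= eps * lam ^+ k * A t].
  by move=> [l0 l1 hl]; exists lam; split => //; exact: powR_le1 l1.
case: hal => [[/alpha_small_aty wy /alpha_small_at0 a0]|/alpha_small_at0 w0|/alpha_small_aty ay].
- have [G [absG mG covG]] := absorbed_near_inward oD Dc0 hN hD s01 r00 Lip0 kap1 charts cover.
  apply: (FOHI_of_cover oD Dc0 hN hD s01 absG far) => //.
  + by move=> eps /(alpha_scale1 hN hD s01 a0)[lam /to_le1].
  + by move=> eps /(alpha_scaleN hN hD s01 wy)[lam /to_ge1].
  + by move=> lam1 lam2 /= l1 l2; exact: covG.
- have absD := absorbed_inward oD Dc0 hN hD s01.
  have small eps : 0 < eps -> exists lam, [/\ 0 < lam, [set l | l <= 1] lam &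
      forall t, 0 <= t -> A (lam `^ s * t) <= eps * lam ^+ n.+1 * A t].
    by move=> /(alpha_scaleN hN hD s01 w0)[lam /to_le1].
  apply: (FOHI_of_cover oD Dc0 hN hD s01 absD absD small small).
  + by move=> lam _; exact: open_measurable_row.
  + by move=> lam _; exact: open_measurable_row.
  + by move=> *; left.
- have [G [absG mG covG]] := absorbed_near_outward oD Dc0 hN hD s01 Rad0 hRad r00 Lip0 kap1 charts cover.
  (* Far from the boundary, lam >= 1 makes the factor lam^(1 - N) harmless. *)
  have far1 : absorbed D A s 1 [set lam | 1 <= lam]
      (fun=> D `&` [set x | r <= dist_compl D x]).
    exact: (absorbed_exponent hN _ _ far).
  have small eps : 0 < eps -> exists lam, [/\ 0 < lam, [set l | 1 <= l] lam &
      forall t, 0 <= t -> A (lam `^ s * t) <= eps * lam ^+ 1 * A t].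
    by move=> /(alpha_scale1 hN hD s01 ay)[lam /to_ge1].
  apply: (FOHI_of_cover oD Dc0 hN hD s01 absG far1 small small) => //.
  by move=> lam1 lam2 /= l1 l2; exact: covG.
Qed.
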